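(* Let $p>0$ and let $(\mathscr A,\mathscr H,D)$ be a $p$-summable spectral triple. Let $q>0$. Then for all $a\in\mathscr A$, $$\big[|D|^{-q},a\big]\in\mathscr L_{(q+1)^{-1}p,\infty}.$$ In fact, there is a constant $C_{D,q}>0$ such that $$\big\|[|D|^{-q},a]\big\|_{(q+1)^{-1}p,\infty}\le C_{D,q}\,\|[D,a]\|\qquad\forall a\in\mathscr A.$$
   Context: A spectral triple $(\mathscr A,\mathscr H,D)$ consists of a unital $*$-algebra $\mathscr A$ represented by bounded operators on a separable Hilbert space $\mathscr H$ (elements are identified with the operators representing them) and an unbounded selfadjoint operator $D$ on $\mathscr H$ with compact resolvent such that $a(\mathrm{dom}\,D)\subseteq \mathrm{dom}\,D$ and $[D,a]$ is bounded for all $a\in\mathscr A$. For a compact operator $T$, $\mu_0(T)\ge\mu_1(T)\ge\cdots$ are its singular values; for $r>0$, $\mathscr L_{r,\infty}$ is the space of compact $T$ with $\|T\|_{r,\infty}=\sup_{j\ge0}(j+1)^{1/r}\mu_j(T)<\infty$. The triple is $p$-summable if the partial inverse $D^{-1}$ (zero on $\ker D$) lies in $\mathscr L_{p,\infty}$. $|D|^{-q}$ is defined by Borel functional calculus with the convention $|D|^{-q}=0$ on $\ker D$. *)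

(* Defs.v *)
(* Analysis over an abstract R : realType; the complex scalars are R[i]. *)
From HB Require Import structures.
From mathcomp Require Import all_boot all_order all_algebra sesquilinear.
From mathcomp Require Import complex.
From mathcomp Require Import all_classical all_reals all_analysis.

Set Implicit Arguments.
Unset Strict Implicit.
Unset Printing Implicit Defensive.

Import Order.TTheory GRing.Theory Num.Theory.
Import numFieldNormedType.Exports.

Local Open Scope classical_set_scope.
Local Open Scope ring_scope.
Local Open Scope complex_scope.

(* Separable complex Hilbert spaces. The inner product is linear in its first
   argument and conjugate-linear in its second one. *)
Record hilbertType (R : realType) := HilbertType {
  hilbert_sort :> completeNormedModType R[i] ;
  dotp : {dot hilbert_sort for Num.conj} ;
  dotp_norm : forall x : hilbert_sort, `|x| ^+ 2 = dotp x x ;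
  hilbert_separable : exists2 S : set hilbert_sort, countable S & dense S
}.

Notation "'<|' x , y '|>'" := (dotp _ x y)
  (at level 0, x, y at level 99, format "<| x ,  y |>") : ring_scope.

Section Operators.
Variables (R : realType) (H : hilbertType R).

(* The norm of the library takes its values in R[i]. *)
Definition hnorm (x : H) : R := complex.Re `|x|.

Definition bounded_op (T : H -> H) : Prop :=
  linear T /\ exists M : R, forall x, hnorm (T x) <= M * hnorm x.

Definition compact_op (T : H -> H) : Prop :=
  linear T /\ precompact (T @` [set x | hnorm x <= 1]).

(* T^* y is the Riesz representative of x |-> <T x, y>; it exists as soon as
   T is bounded. *)
Definition adjoint (T : H -> H) (y : H) : H :=
  xget 0 [set z | forall x, <|T x, y|> = <|x, z|>].

(* A possibly unbounded operator; the values of [app] outside [dom] carry no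
   meaning. *)
Record operator := Operator { dom : set H ; app :> H -> H }.

Definition linear_op (D : operator) : Prop :=
  dom D 0 /\
  forall (c : R[i]) x y, dom D x -> dom D y ->
    dom D (c *: x + y) /\ D (c *: x + y) = c *: D x + D y.

(* The last clause is the equality of the graphs of D and of its adjoint. *)
Definition selfadjoint (D : operator) : Prop :=
  [/\ linear_op D, dense (dom D) &
      forall y z, (dom D y /\ D y = z) <->
                  (forall x, dom D x -> <|D x, y|> = <|x, z|>)].

Definition is_resolvent (D : operator) (c : R[i]) (S : H -> H) : Prop :=
  [/\ bounded_op S,
      forall y, dom D (S y) /\ D (S y) - c *: S y = y &
      forall x, dom D x -> S (D x - c *: x) = x].

Definition compact_resolvent (D : operator) : Prop :=
  exists c S, is_resolvent D c S /\ compact_op S.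

Definition commutator (P : operator) (a : H -> H) : operator :=
  Operator [set x | dom P x /\ dom P (a x)] (fun x => P (a x) - a (P x)).

(* For a densely defined bounded T, this is also the norm of its bounded
   extension to H. *)
Definition opnorm (T : operator) : R :=
  sup [set hnorm (T x) | x in [set x | dom T x /\ hnorm x <= 1]].

Definition dirac_operator (D : operator) : Prop :=
  selfadjoint D /\ compact_resolvent D.

Record spectral_triple (A : set (H -> H)) (D : operator) : Prop := {
  st_dirac : dirac_operator D ;
  st_bounded : forall a, A a -> bounded_op a ;
  st_one : A id ;
  st_add : forall a b, A a -> A b -> A (a \+ b) ;
  st_scale : forall (c : R[i]) a, A a -> A (fun x => c *: a x) ;
  st_mul : forall a b, A a -> A b -> A (a \o b) ;
  st_star : forall a, A a -> A (adjoint a) ;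
  st_dom : forall a, A a -> a @` dom D `<=` dom D ;
  st_comm : forall a, A a ->
    exists M : R, forall x, dom D x -> hnorm (commutator D a x) <= M * hnorm x
}.

(* The (j+1)-st largest eigenvalue of a nonnegative selfadjoint compact S,
   counted with multiplicity and padded with zeros: the largest l such that S
   has j+1 orthonormal eigenvectors with eigenvalues at least l. *)
Definition ordered_eigenvalue (S : H -> H) (j : nat) : R :=
  sup [set l : R | l = 0 \/ exists v : 'I_j.+1 -> H,
    (forall i k, <|v i, v k|> = (i == k)%:R) /\
    (forall i, exists2 m : R, l <= m & S (v i) = m%:C *: v i)].

Definition singular_value (T : H -> H) (j : nat) : R :=
  Num.sqrt (ordered_eigenvalue (adjoint T \o T) j).

Definition weak_norm (r : R) (T : H -> H) : \bar R :=
  ereal_sup (range (fun j : nat =>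
    (j.+1%:R `^ r^-1 * singular_value T j)%:E)).

Definition weak_schatten (r : R) (T : operator) : Prop :=
  [/\ dom T = setT, compact_op T & (weak_norm r T < +oo)%E].

Definition ker_op (D : operator) : set H := [set k | dom D k /\ D k = 0].

(* S is the operator on ker D + ran D which vanishes on ker D and inverts the
   restriction of D to the orthogonal complement of ker D. *)
Definition is_partial_inverse (D S : operator) : Prop :=
  forall y x, (dom S y /\ S y = x) <->
    [/\ dom D x, forall k, ker_op D k -> <|x, k|> = 0 & ker_op D (y - D x)].

Definition summable_op (p : R) (D : operator) : Prop :=
  exists2 S, is_partial_inverse D S & weak_schatten p S.

(* Projection-valued measures on the Borel sets of R. *)
Record is_pvm (E : set (measurableTypeR R) -> H -> H) : Prop := {
  pvm_bounded : forall B, measurable B -> bounded_op (E B) ;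
  pvm_selfadj : forall B, measurable B ->
    forall x y, <|E B x, y|> = <|x, E B y|> ;
  pvm_setT : E setT = id ;
  pvm_setI : forall B1 B2, measurable B1 -> measurable B2 ->
    E (B1 `&` B2) = E B1 \o E B2 ;
  pvm_sigma : forall F : nat -> set (measurableTypeR R),
    (forall n, measurable (F n)) -> trivIset setT F ->
    forall x, series (fun n => E (F n) x) @ \oo --> E (\bigcup_n F n) x
}.

(* The measure B |-> <E(B)x, x>, which equals |E(B)x|^2 since E(B) is an
   orthogonal projection. *)
Definition pvm_measure (E : set (measurableTypeR R) -> H -> H) (x : H)
    (B : set (measurableTypeR R)) : \bar R :=
  (hnorm (E B x) ^+ 2)%:E.

(* P is the integral of f against E, for a real-valued Borel function f: its
   domain consists of the x for which f is square-integrable against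
   <E(.)x, x>, and its quadratic form (which determines P, by polarization)
   is the integral of f. *)
Definition is_spectral_integral (E : set (measurableTypeR R) -> H -> H)
    (f : R -> R) (P : operator) : Prop :=
  [/\ linear_op P,
      forall x, dom P x <->
        (\int[pvm_measure E x]_(l in [set: measurableTypeR R])
            (f l ^+ 2)%:E < +oo)%E &
      forall x, dom P x ->
        <|P x, x|> =
        (fine (\int[pvm_measure E x]_(l in [set: measurableTypeR R])
                  (f l)%:E)%E)%:C].

(* P = f(D), where the spectral measure E of D is characterized by
   D = \int l dE(l). *)
Definition borel_calculus (D : operator) (f : R -> R) (P : operator) : Prop :=
  exists E, [/\ is_pvm E, is_spectral_integral E id D &
                is_spectral_integral E f P].

Definition abs_neg_power (q : R) (l : R) : R :=
  if l == 0 then 0 else `|l| `^ (- q).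

End Operators.

Arguments abs_neg_power {R} q l.

(* Main.v *)
(* Let T = [|D|^-q, a], let Q be the spectral projection of D onto |l| >= L, and
   let j be an index. T differs from Q T Q by an operator of rank at most
   2 rank(1 - Q), and rank(1 - Q) = O(L^p) by p-summability (plus the dimension
   of ker D); so the singular value bound follows from
   |Q T Q| <= C L^(-q-1) |[D, a]| with L of order j^(1/p).
   In an eigenbasis of D, Q T Q is the Schur product of [D, a] with the divided
   differences of |l|^-q. For l, m of opposite signs their Schur norm is that of
   (|l|^-q - |m|^-q) / (|l| + |m|), and 1 / (x + y) has Schur norm at most
   1 / (2 L) on x, y >= L by a geometric series. For l, m of the same sign and
   q = k / 2^n one iterates x - y = (sqrt x - sqrt y) (sqrt x + sqrt y), which
   reduces to the same kernel; general q follows by density of dyadic numbers.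
   The eigenbasis is obtained without the spectral theorem for compact operators:
   for bounded B the range of E(B) is finite-dimensional because x = S(D x - c x)
   with S the compact resolvent, and a Hermitian matrix can be diagonalized. *)
Require Import Defs.
From HB Require Import structures.
From mathcomp Require Import all_boot all_order all_algebra sesquilinear spectral.
From mathcomp Require Import complex.
From mathcomp Require Import all_classical all_reals all_analysis.
From mathcomp Require Import measurable_realfun.
From mathcomp Require Import zify ring lra.

Set Implicit Arguments.
Unset Strict Implicit.
Unset Printing Implicit Defensive.

Import Order.TTheory GRing.Theory Num.Theory.
Import numFieldNormedType.Exports.

Local Open Scope classical_set_scope.
Local Open Scope ring_scope.
Local Open Scope complex_scope.

(** * Schur multipliers *)

Section ComplexModulus.
Variable R : realType.
Implicit Types (z w : R[i]) (x : R).

(** All matrix estimates must be uniform in the size of the matrix: the truncations [|l| < n] that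
    make it finite are removed by a limit, so constants depending on a dimension are of no use. This
    is why every kernel is built from rank-one kernels by sums, products and limits, with the norm
    tracked throughout; iterated square roots take the place of the usual integral formulas for
    powers. Homogeneity fixes the exponent: dividing the eigenvalues by [L] reduces to modulus at
    least 1 and leaves the factor L^(-q) / L, which is of order j^(-(q+1)/p) for L of order j^(1/p).
    The rank argument needs j + 1 > 2 rank(1 - Q) and breaks down for small j. There the gap between
    0 and the rest of the spectrum bounds the norm of T itself, with Q = 1. Compactness of T needs
    its own proof: singular values are defined through eigenvectors, so an operator without
    eigenvectors would have none but zero ones. *)

Definition cnorm z : R := complex.Re `|z|.

Lemma cnormE z : `|z| = (cnorm z)%:C.
Proof. by rewrite /cnorm RRe_real // normr_real. Qed.

Lemma cnorm_ge0 z : 0 <= cnorm z.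
Proof. by rewrite -lecR -cnormE normr_ge0. Qed.

Lemma cnormM z w : cnorm (z * w) = cnorm z * cnorm w.
Proof. by apply: complexI; rewrite rmorphM /= -!cnormE normrM. Qed.

Lemma cnormD z w : cnorm (z + w) <= cnorm z + cnorm w.
Proof. by rewrite -lecR rmorphD /= -!cnormE ler_normD. Qed.

Lemma cnormN z : cnorm (- z) = cnorm z.
Proof. by rewrite /cnorm normrN. Qed.

Lemma cnorm0 : cnorm 0 = 0.
Proof. by rewrite /cnorm normr0. Qed.

Lemma cnormC x : cnorm x%:C = `|x|.
Proof. by apply: complexI; rewrite -cnormE normc_def /= expr0n /= addr0 sqrtr_sqr. Qed.

Lemma cnorm_conj z : cnorm (Num.conj z) = cnorm z.
Proof. by rewrite /cnorm norm_conjC. Qed.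

Lemma conjC_real x : Num.conj (x%:C : R[i]) = x%:C.
Proof. exact: conjc_real. Qed.

Lemma cnorm_sum (I : Type) (r : seq I) (P : pred I) (F : I -> R[i]) :
  cnorm (\sum_(i <- r | P i) F i) <= \sum_(i <- r | P i) cnorm (F i).
Proof.
elim/big_ind2: _ => [|a b c d ab cd|//]; first by rewrite cnorm0.
by apply: le_trans (cnormD _ _) _; apply: lerD.
Qed.

Lemma cnorm_sqr z : (cnorm z ^+ 2)%:C = z * Num.conj z.
Proof. by rewrite rmorphXn /= -cnormE sqr_normc. Qed.

Lemma cnorm_eq0 z : (cnorm z == 0) = (z == 0).
Proof. by rewrite -(inj_eq (@complexI R)) -cnormE normr_eq0. Qed.

End ComplexModulus.

Section SchurMultipliers.
Variables (R : realType) (I J : finType).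
Implicit Types (t a : I -> J -> R[i]) (M C : R) (phi psi : I -> J -> R).

Definition sqn (K : finType) (x : K -> R[i]) : R := \sum_k cnorm (x k) ^+ 2.

(* |t(x, y)| <= M |x| |y|, in a quadratic form that avoids square roots. *)
Definition form_le t M : Prop := forall (x : I -> R[i]) (y : J -> R[i]),
  cnorm (\sum_i \sum_j t i j * x i * y j) <= M * ((sqn x + sqn y) / 2).

Definition kmul phi t i j : R[i] := (phi i j)%:C * t i j.

(** The Schur multiplier norm of [phi] is at most [C]. In the quadratic form of [form_le], norms
    still multiply under products of kernels. *)
Definition schur phi C : Prop :=
  forall t M, 0 <= M -> form_le t M -> form_le (kmul phi t) (C * M).

Lemma sqn_ge0 (K : finType) (x : K -> R[i]) : 0 <= sqn x.
Proof. by apply: sumr_ge0 => k _; rewrite exprn_ge0 ?cnorm_ge0. Qed.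

Lemma eq_form_le t t' M : (forall i j, t i j = t' i j) ->
  form_le t M -> form_le t' M.
Proof.
move=> tt' tM x y.
rewrite (eq_bigr (fun i => \sum_j t i j * x i * y j)) => [|i _]; first exact: tM.
by apply: eq_bigr => j _; rewrite tt'.
Qed.

Lemma form_leW t M M' : M <= M' -> form_le t M -> form_le t M'.
Proof.
move=> MM' tM x y; apply: le_trans (tM x y) _; apply: ler_wpM2r => //.
by rewrite divr_ge0 // addr_ge0 // sqn_ge0.
Qed.

Lemma form_leD t t' M M' : form_le t M -> form_le t' M' ->
  form_le (fun i j => t i j + t' i j) (M + M').
Proof.
move=> tM tM' x y.
rewrite (eq_bigr (fun i => (\sum_j t i j * x i * y j) +
  (\sum_j t' i j * x i * y j))) => [|i _]; last first.
  by rewrite -big_split; apply: eq_bigr => j _; rewrite !mulrDl.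
rewrite big_split mulrDl; apply: le_trans (cnormD _ _) _; exact: lerD.
Qed.

Lemma form_leZ t M (c : R) : form_le t M ->
  form_le (fun i j => c%:C * t i j) (`|c| * M).
Proof.
move=> tM x y.
rewrite (eq_bigr (fun i => c%:C * \sum_j t i j * x i * y j)) => [|i _]; last first.
  by rewrite mulr_sumr; apply: eq_bigr => j _; rewrite !mulrA.
by rewrite -mulr_sumr cnormM cnormC -mulrA ler_wpM2l.
Qed.

(** For fixed [x] and [y] the form is a finite sum, so entrywise approximation with one common [M]
    suffices. *)
Lemma form_le_lim t M : (forall e : R, 0 < e -> exists2 t', form_le t' M &
  forall i j, cnorm (t i j - t' i j) <= e) -> form_le t M.
Proof.
move=> tlim x y.
pose S := \sum_i \sum_j cnorm (x i) * cnorm (y j).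
have S0 : 0 <= S.
  by apply: sumr_ge0 => i _; apply: sumr_ge0 => j _; rewrite mulr_ge0 ?cnorm_ge0.
apply/ler_addgt0Pr => e e0.
have e'0 : 0 < e / (S + 1) by rewrite divr_gt0 // ltr_pwDr.
have [t' t'M tt'] := tlim _ e'0.
have -> : \sum_i \sum_j t i j * x i * y j =
   \sum_i \sum_j t' i j * x i * y j + \sum_i \sum_j (t i j - t' i j) * x i * y j.
  rewrite -big_split; apply: eq_bigr => i _; rewrite -big_split /=.
  by apply: eq_bigr => j _; rewrite -!mulrDl addrC subrK.
apply: le_trans (cnormD _ _) _; apply: lerD; first exact: t'M.
have : cnorm (\sum_i \sum_j (t i j - t' i j) * x i * y j) <= e / (S + 1) * S.
  apply: le_trans (cnorm_sum _ _ _) _; rewrite mulr_sumr.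
  apply: ler_sum => i _; apply: le_trans (cnorm_sum _ _ _) _; rewrite mulr_sumr.
  by apply: ler_sum => j _; rewrite !cnormM -mulrA ler_wpM2r // mulr_ge0 ?cnorm_ge0.
move/le_trans; apply; rewrite mulrAC ler_pdivrMr ?ltr_pwDr //.
by apply: ler_wpM2l; rewrite ?lerDl // ltW.
Qed.

Lemma eq_schur phi psi C : (forall i j, phi i j = psi i j) ->
  schur phi C -> schur psi C.
Proof.
move=> e s t M M0 tM; apply: eq_form_le (s t M M0 tM) => i j.
by rewrite /kmul e.
Qed.

Lemma schurW phi C C' : C <= C' -> schur phi C -> schur phi C'.
Proof.
move=> CC' s t M M0 tM; apply: form_leW (s t M M0 tM); exact: ler_wpM2r.
Qed.

Lemma schurD phi psi C C' : schur phi C -> schur psi C' ->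
  schur (fun i j => phi i j + psi i j) (C + C').
Proof.
move=> s s' t M M0 tM; rewrite mulrDl.
apply: eq_form_le (form_leD (s _ _ M0 tM) (s' _ _ M0 tM)) => i j.
by rewrite /kmul rmorphD mulrDl.
Qed.

Lemma schurZ phi C c : schur phi C ->
  schur (fun i j => c * phi i j) (`|c| * C).
Proof.
move=> s t M M0 tM; rewrite -mulrA.
apply: eq_form_le (form_leZ c (s _ _ M0 tM)) => i j.
by rewrite /kmul rmorphM mulrA.
Qed.

Lemma schurM phi psi C C' : 0 <= C -> schur phi C -> schur psi C' ->
  schur (fun i j => psi i j * phi i j) (C' * C).
Proof.
move=> C0 s s' t M M0 tM; rewrite -mulrA.
apply: eq_form_le (s' _ _ (mulr_ge0 C0 M0) (s _ _ M0 tM)) => i j.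
by rewrite /kmul rmorphM mulrA.
Qed.

Lemma schur0 : schur (fun _ _ => 0) 0.
Proof.
move=> t M M0 tM x y; rewrite !mul0r big1 ?cnorm0 // => i _.
by rewrite big1 // => j _; rewrite /kmul !mul0r.
Qed.

Lemma schur_sum n (phi : nat -> I -> J -> R) (C : nat -> R) :
  (forall k, schur (phi k) (C k)) ->
  schur (fun i j => \sum_(k < n) phi k i j) (\sum_(k < n) C k).
Proof.
move=> s; elim: n => [|n ih].
  by rewrite big_ord0; apply: eq_schur schur0 => i j; rewrite big_ord0.
rewrite big_ord_recr /=; apply: eq_schur (schurD ih (s n)) => i j.
by rewrite big_ord_recr.
Qed.

Lemma schur_lim phi C : (forall e : R, 0 < e -> exists2 psi, schur psi C &
  forall i j, `|phi i j - psi i j| <= e) -> schur phi C.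
Proof.
move=> lim t M M0 tM; apply: form_le_lim => e e0.
pose S := \sum_i \sum_j cnorm (t i j).
have S0 : 0 <= S.
  by apply: sumr_ge0 => i _; apply: sumr_ge0 => j _; rewrite cnorm_ge0.
have e'0 : 0 < e / (S + 1) by rewrite divr_gt0 // ltr_pwDr.
have [psi psiC lpsi] := lim _ e'0.
exists (kmul psi t); first exact: psiC.
move=> i j; rewrite /kmul -mulrBl -rmorphB cnormM cnormC.
have tS : cnorm (t i j) <= S.
  rewrite /S (bigD1 i) //= (bigD1 j) //= -addrA lerDl addr_ge0 //.
    by apply: sumr_ge0 => k _; rewrite cnorm_ge0.
  by apply: sumr_ge0 => k _; apply: sumr_ge0 => l _; rewrite cnorm_ge0.
apply: le_trans (ler_pM _ _ (lpsi i j) tS) _ => //; first exact: cnorm_ge0.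
rewrite mulrAC ler_pdivrMr ?ltr_pwDr //.
by apply: ler_wpM2l; rewrite ?lerDl // ltW.
Qed.

(** A rank-one kernel can be absorbed into [x] and [y]. This is done for b = c = 1 first: in the
    quadratic form, absorbing directly would give b^2 |x|^2 + c^2 |y|^2 instead of the factor b
    c. *)
Lemma schur_rank1 (u : I -> R) (v : J -> R) (b c : R) :
  0 <= b -> 0 <= c -> (forall i, `|u i| <= b) -> (forall j, `|v j| <= c) ->
  schur (fun i j => u i * v j) (b * c).
Proof.
have unit1 u' v' : (forall i, `|u' i| <= 1) -> (forall j, `|v' j| <= 1) ->
    schur (fun i j => u' i * v' j) 1.
  move=> u1 v1 t M M0 tM x y.
  have sq : forall (K : finType) (w : K -> R) (z : K -> R[i]),
      (forall k, `|w k| <= 1) -> sqn (fun k => (w k)%:C * z k) <= sqn z.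
    move=> K w z w1; apply: ler_sum => k _; rewrite cnormM cnormC exprMn.
    by rewrite ler_piMl ?exprn_ge0 ?cnorm_ge0 // exprn_ile1.
  have := tM (fun i => (u' i)%:C * x i) (fun j => (v' j)%:C * y j).
  rewrite (eq_bigr (fun i => \sum_j kmul (fun i j => u' i * v' j) t i j * x i * y j)).
    move/le_trans; apply; rewrite mul1r ler_wpM2l // ler_wpM2r ?invr_ge0 //.
    by apply: lerD; apply: sq.
  move=> i _; apply: eq_bigr => j _; rewrite /kmul rmorphM /=; ring.
move=> b0 c0 ub vc.
case: (eqVneq b 0) => [b00|bn0].
  rewrite b00 mul0r; apply: eq_schur schur0 => i j.
  by have := ub i; rewrite b00 normr_le0 => /eqP ->; rewrite mul0r.
case: (eqVneq c 0) => [c00|cn0].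
  rewrite c00 mulr0; apply: eq_schur schur0 => i j.
  by have := vc j; rewrite c00 normr_le0 => /eqP ->; rewrite mulr0.
have bp : 0 < b by rewrite lt_neqAle eq_sym bn0.
have cp : 0 < c by rewrite lt_neqAle eq_sym cn0.
have := @schurZ _ _ (b * c) (unit1 (fun i => u i / b) (fun j => v j / c) _ _).
rewrite ger0_norm ?mulr_ge0 // mulr1 => h.
apply: eq_schur (h _ _) => [i j|i|j].
- by field; rewrite bn0 cn0.
- by rewrite normrM normfV (ger0_norm b0) ler_pdivrMr // mul1r.
- by rewrite normrM normfV (ger0_norm c0) ler_pdivrMr // mul1r.
Qed.

Lemma schurX phi C n : 0 <= C -> schur phi C ->
  schur (fun i j => phi i j ^+ n) (C ^+ n).
Proof.
move=> C0 s; elim: n => [|n ih].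
  apply: (@eq_schur (fun i j => 1 * 1)) => [i j|]; first by rewrite mul1r.
  have -> : C ^+ 0 = 1 * 1 by rewrite expr0 mulr1.
  by apply: schur_rank1 => // ?; rewrite normr1.
rewrite exprS; apply: eq_schur (schurM _ ih s) => [i j|]; last exact: exprn_ge0.
by rewrite exprS.
Qed.

End SchurMultipliers.

Section SchurPower.
Variable R : realType.

Section TwoFamilies.
Variables (I J : finType) (u : I -> R) (v : J -> R).

(** Write u + v = 2B (1 - r), where r is the sum of (B - u) / 2B and (B - v) / 2B. Each summand
    depends on one index only, so r has norm at most rho = 1 - m / B < 1 and 1 / (1 - r) is a
    geometric series. *)
Lemma schur_inv_sum m : 0 < m -> (forall i, m <= u i) -> (forall j, m <= v j) ->
  schur (fun i j => (u i + v j)^-1) (2 * m)^-1.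
Proof.
move=> m0 mu mv.
(* Any common upper bound of the values would do: [B] cancels in 1 / (2B (1 - rho)) = 1 / (2m). *)
pose B := m + (\sum_i u i + \sum_j v j).
have u0 i : 0 <= u i by apply: le_trans (mu i); apply: ltW.
have v0 j : 0 <= v j by apply: le_trans (mv j); apply: ltW.
have le_sum (K : finType) (w : K -> R) k : (forall l, 0 <= w l) -> w k <= \sum_l w l.
  by move=> w0; rewrite (bigD1 k) //= lerDl sumr_ge0.
have uB i : u i <= B.
  apply: le_trans (le_sum _ _ i u0) _.
  by rewrite /B addrCA lerDl addr_ge0 ?sumr_ge0 // ltW.
have vB j : v j <= B.
  apply: le_trans (le_sum _ _ j v0) _.
  by rewrite /B addrA lerDr addr_ge0 ?sumr_ge0 // ltW.
have mB : m <= B by rewrite /B lerDl addr_ge0 // sumr_ge0.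
have B0 : 0 < B by apply: lt_le_trans mB.
have B2i : 0 <= (2 * B)^-1 by rewrite invr_ge0 mulr_ge0 // ltW.
pose rho := (B - m) / B.
have rho0 : 0 <= rho by rewrite divr_ge0 ?subr_ge0 // ltW.
have rho1 : rho < 1 by rewrite ltr_pdivrMr // mul1r ltrBlDr ltrDl.
pose r i j := (B - u i) / (2 * B) + (B - v j) / (2 * B).
have sr : schur r rho.
  have -> : rho = (B - m) / (2 * B) * 1 + 1 * ((B - m) / (2 * B)).
    by rewrite /rho; field; rewrite gt_eqF.
  have Bm0 : 0 <= (B - m) / (2 * B) by rewrite divr_ge0 ?subr_ge0 // mulr_ge0 // ltW.
  apply: (@eq_schur _ _ _ (fun i j => (B - u i) / (2 * B) * 1 + 1 * ((B - v j) / (2 * B)))).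
    by move=> i j; rewrite mulr1 mul1r.
  apply: schurD; apply: schur_rank1 => // k; rewrite ?normr1 // ger0_norm.
  - by apply: ler_wpM2r => //; rewrite lerD2l lerN2.
  - by rewrite divr_ge0 ?subr_ge0 // mulr_ge0 // ltW.
  - by apply: ler_wpM2r => //; rewrite lerD2l lerN2.
  - by rewrite divr_ge0 ?subr_ge0 // mulr_ge0 // ltW.
have rE i j : 1 - r i j = (u i + v j) / (2 * B).
  by rewrite /r; field; rewrite gt_eqF.
have r_ge0 i j : 0 <= r i j.
  by rewrite addr_ge0 // divr_ge0 ?subr_ge0 // mulr_ge0 // ltW.
have r_rho i j : r i j <= rho.
  rewrite -lerN2 -(lerD2l 1) rE.
  have -> : 1 - rho = (m + m) / (2 * B) by rewrite /rho; field; rewrite gt_eqF.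
  by apply: ler_wpM2r => //; apply: lerD.
apply: schur_lim => e e0.
have [k rk] : exists k, rho ^+ k / (2 * m) <= e.
  have /cvgrPdist_lt /(_ e e0) : (fun k => (2 * m)^-1 * rho ^+ k) @ \oo --> (0 : R).
    by apply: cvg_geometric; rewrite ger0_norm.
  case=> k _ /(_ k (leqnn k)); rewrite sub0r normrN => h.
  exists k; rewrite mulrC; exact: le_trans (ler_norm _) (ltW h).
exists (fun i j => (2 * B)^-1 * \sum_(l < k) r i j ^+ l).
  have := @schur_sum _ _ _ k (fun l i j => r i j ^+ l) (fun l => rho ^+ l)
    (fun l => schurX l rho0 sr).
  move=> /(schurZ (2 * B)^-1); apply: schurW.
  rewrite ger0_norm //.
  have S0 : 0 < 1 - rho by rewrite subr_gt0.
  have : (1 - rho) * (\sum_(l < k) rho ^+ l) <= 1.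
    by rewrite -opprB mulNr -subrX1 opprB gerBl exprn_ge0.
  rewrite mulrC -ler_pdivlMr // => /(ler_wpM2l B2i) h.
  apply: le_trans h _.
  rewrite (_ : (2 * B)^-1 * (1 / (1 - rho)) = (2 * m)^-1) //.
  by rewrite /rho; field; rewrite gt_eqF //= gt_eqF //= opprB addrC subrK gt_eqF.
move=> i j.
have uv0 : 0 < u i + v j by rewrite (lt_le_trans m0) // ler_wpDr.
(* The tail of the geometric series, at most rho^k / (2m) by the choice of [k]. *)
have -> : (u i + v j)^-1 - (2 * B)^-1 * \sum_(l < k) r i j ^+ l =
    r i j ^+ k / (u i + v j).
  have := subrX1 (r i j) k; rewrite -[r i j - 1]opprB rE => h.
  have -> : r i j ^+ k = 1 - (u i + v j) / (2 * B) * \sum_(l < k) r i j ^+ l.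
    by rewrite -mulNr -h addrC subrK.
  by field; rewrite gt_eqF // gt_eqF.
rewrite ger0_norm; last by apply: divr_ge0; [apply: exprn_ge0|apply: ltW].
apply: le_trans rk.
apply: ler_pM; [exact: exprn_ge0|by rewrite invr_ge0 ltW| |].
  by apply: lerXn2r; rewrite ?nnegrE.
by rewrite lef_pV2 ?posrE ?mulr_gt0 // mulr_natl mulr2n lerD.
Qed.

End TwoFamilies.

(** * Lipschitz bounds for negative powers *)

Section DyadicPowers.
Variables (I J : finType) (u : I -> R) (v : J -> R).
Hypotheses (u1 : forall i, 1 <= u i) (v1 : forall j, 1 <= v j).

Let root n (x : R) : R := x `^ (2^-1 ^+ n).

Let root_ge1 n x : 1 <= x -> 1 <= root n x.
Proof.
move=> x1; rewrite -[X in X <= _](powRr0 x) /root.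
by apply: ler_powR => //; rewrite exprn_ge0.
Qed.

Let rootS n x : 1 <= x -> root n.+1 x ^+ 2 = root n x.
Proof.
move=> x1; have x0 : 0 <= x by apply: le_trans x1.
rewrite -powR_mulrn ?powR_ge0 // -powRrM exprS mulrC mulrA mulfV ?mul1r //.
Qed.

(** Each square root divides the kernel by a sum of two roots that are at least 1, which costs a
    factor 1/2. The resulting 2^(-n) is the derivative of x^(2^(-n)) at 1, so nothing is lost. *)
Let root_diff n : exists2 phi, schur phi (2^-1 ^+ n) &
  forall i j, root n (u i) - root n (v j) = phi i j * (u i - v j).
Proof.
elim: n => [|n [phi sphi phiE]].
  exists (fun i j => 1 * 1).
    have -> : (2^-1 ^+ 0 : R) = 1 * 1 by rewrite expr0 mulr1.
    by apply: schur_rank1 => // ?; rewrite normr1.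
  by move=> i j; rewrite /root expr0 !powRr1 ?mul1r ?(le_trans _ (u1 i)) ?(le_trans _ (v1 j)).
exists (fun i j => (root n.+1 (u i) + root n.+1 (v j))^-1 * phi i j).
  rewrite exprS; apply: schurM sphi _; first by rewrite exprn_ge0.
  rewrite -[X in schur _ X^-1]mulr1; apply: schur_inv_sum => // k; exact: root_ge1.
move=> i j; rewrite -mulrA -phiE -(rootS n (u1 i)) -(rootS n (v1 j)) subr_sqr.
rewrite mulrCA mulVf ?mulr1 //.
by rewrite gt_eqF // ltr_wpDr ?powR_ge0 // (lt_le_trans ltr01) // root_ge1.
Qed.

(** With X and Y the inverse roots, X^k - Y^k is (X - Y) times k rank-one kernels of norm at most 1,
    and 1/x - 1/y = -(x - y) / (x y) reduces X - Y to [root_diff]. This explains the sign and the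
    extra factors [X i] and [Y j]. *)
Let dyadic_diff k n : exists2 phi, schur phi (k%:R * 2^-1 ^+ n) &
  forall i j, u i `^ (- (k%:R * 2^-1 ^+ n)) - v j `^ (- (k%:R * 2^-1 ^+ n)) =
    phi i j * (u i - v j).
Proof.
have [phi sphi phiE] := root_diff n.
pose X i := (root n (u i))^-1; pose Y j := (root n (v j))^-1.
have root_inv x : 1 <= x -> 0 <= (root n x)^-1 <= 1.
  move=> x1; rewrite invr_ge0 powR_ge0 /=.
  by rewrite invf_le1 ?root_ge1 // (lt_le_trans ltr01) // root_ge1.
exists (fun i j => -1 * ((\sum_(l < k) (X i ^+ (k.-1 - l) * X i) * (Y j ^+ l * Y j)) * phi i j)).
  have -> : k%:R * 2^-1 ^+ n = `|-1| * ((\sum_(l < k) 1 * 1) * 2^-1 ^+ n) :> R.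
    rewrite normrN1 mul1r; congr (_ * _).
    by rewrite (eq_bigr (fun=> 1)) => [|l _]; rewrite ?mulr1 // sumr_const card_ord.
  apply: schurZ; apply: schurM sphi _; first by rewrite exprn_ge0.
  apply: (@schur_sum _ _ _ k
    (fun l i j => (X i ^+ (k.-1 - l) * X i) * (Y j ^+ l * Y j)) (fun=> 1 * 1)) => l.
  have root_invX x m : 1 <= x -> `|(root n x)^-1 ^+ m * (root n x)^-1| <= 1.
    move=> /root_inv /andP[x0 x1]; rewrite -exprSr normrX ger0_norm //.
    by rewrite exprn_ile1.
  by apply: schur_rank1 => // ?; exact: root_invX.
move=> i j.
have powE x : 1 <= x -> x `^ (- (k%:R * 2^-1 ^+ n)) = (root n x)^-1 ^+ k.
  move=> x1; rewrite powRN mulrC powRrM powR_mulrn ?powR_ge0 //.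
  exact: esym (exprVn _ _).
rewrite !powE // subrXX.
rewrite (_ : _^-1 - _^-1 = - (root n (u i) - root n (v j)) * X i * Y j); last first.
  rewrite /X /Y; field.
  by rewrite !gt_eqF // (lt_le_trans ltr01) // root_ge1.
rewrite phiE [in RHS](eq_bigr (fun l : 'I_k => (X i * Y j) * (X i ^+ (k.-1 - l) * Y j ^+ l))).
  rewrite -mulr_sumr. rewrite -/(X i) -/(Y j).
  set S := \sum_(l < k) X i ^+ (k.-1 - l) * Y j ^+ l; ring.
by move=> l _; rewrite mulrACA mulrC.
Qed.

(* The conclusion is about entries of the form (u_i - v_j) a_ij rather than about
   a kernel of divided differences, so that the limit in q needs no value of the
   kernel at u_i = v_j. *)
Lemma powR_schur_lipschitz q a M : 0 <= q -> 0 <= M ->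
  form_le (kmul (fun i j => u i - v j) a) M ->
  form_le (kmul (fun i j => u i `^ (- q) - v j `^ (- q)) a) (q * M).
Proof.
move=> q0 M0 aM; apply: form_le_lim => e e0.
(* [L] dominates every logarithm and [S] every entry; the exponent will be approximated up to
   2^(-n), which changes an entry by at most 2 L S 2^(-n). *)
pose L := \sum_i ln (u i) + \sum_j ln (v j).
pose S := \sum_i \sum_j cnorm (a i j).
have S0 : 0 <= S.
  by apply: sumr_ge0 => i _; apply: sumr_ge0 => j _; rewrite cnorm_ge0.
have lnu0 i : 0 <= ln (u i) by exact: ln_ge0.
have lnv0 j : 0 <= ln (v j) by exact: ln_ge0.
have L0 : 0 <= L by rewrite addr_ge0 // sumr_ge0.
have le_sum (K : finType) (w : K -> R) k : (forall l, 0 <= w l) -> w k <= \sum_l w l.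
  by move=> w0; rewrite (bigD1 k) //= lerDl sumr_ge0.
have [n hn] : exists n, 2 * L * S * 2^-1 ^+ n <= e.
  have /cvgrPdist_lt /(_ e e0) : (fun k => (2 * L * S) * 2^-1 ^+ k) @ \oo --> (0 : R).
    by apply: cvg_geometric; rewrite ger0_norm // invf_lt1 // ltr1n.
  case=> k _ /(_ k (leqnn k)); rewrite sub0r normrN => h.
  exists k; exact: le_trans (ler_norm _) (ltW h).
pose s : R := 2^-1 ^+ n.
have s0 : 0 < s by rewrite exprn_gt0.
(* Approximation of [q] from below, so that k s M <= q M. *)
pose k := Num.trunc (q / s).
have /andP[kl kr] : k%:R * s <= q < (k%:R + 1) * s.
  rewrite -ler_pdivlMr // -ltr_pdivrMr // natr1.
  by have := Num.Theory.trunc_itv (divr_ge0 q0 (ltW s0)).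
have [phi sphi phiE] := dyadic_diff k n.
pose g x := x `^ (- (k%:R * s)).
exists (kmul (fun i j => g (u i) - g (v j)) a).
  apply: form_leW (_ : k%:R * s * M <= _) _; first exact: ler_wpM2r.
  apply: eq_form_le (sphi _ _ M0 aM) => i j.
  by rewrite /kmul /g phiE rmorphM mulrA.
(* This is 1 - exp(-h) <= h with h = (q - k s) ln x, since [g x] is at most 1. *)
have gE x : 1 <= x -> `|x `^ (- q) - g x| <= s * ln x.
  move=> x1.
  have x0 : 0 < x by apply: lt_le_trans x1.
  have lx : 0 <= ln x by exact: ln_ge0.
  rewrite distrC ger0_norm; last by rewrite subr_ge0 ler_powR // lerN2.
  have -> : g x - x `^ (- q) = g x * (1 - x `^ (- (q - k%:R * s))).
    rewrite mulrBr mulr1; congr (_ - _).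
    rewrite /g -powRD; first by congr (_ `^ _); ring.
    by rewrite (gt_eqF x0) implybT.
  have g1 : g x <= 1.
    rewrite -[leRHS](powRr0 x); apply: ler_powR => //.
    by rewrite oppr_le0 mulr_ge0 // ltW.
  apply: le_trans (_ : 1 - x `^ (- (q - k%:R * s)) <= _).
    rewrite ler_piMl ?subr_ge0 // -[leRHS](powRr0 x); apply: ler_powR => //.
    by rewrite oppr_le0 subr_ge0.
  rewrite /powR gt_eqF // lerBlDr -lerBlDl.
  apply: le_trans (expR_ge1Dx _); rewrite mulNr lerD2l lerN2.
  apply: ler_wpM2r => //; rewrite lerBlDl -[X in _ + X]mul1r -mulrDl.
  exact: ltW.
move=> i j; rewrite /kmul -mulrBl -rmorphB cnormM cnormC.
have -> : u i `^ (- q) - v j `^ (- q) - (g (u i) - g (v j)) =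
   (u i `^ (- q) - g (u i)) - (v j `^ (- q) - g (v j)) by ring.
have aS : cnorm (a i j) <= S.
  apply: le_trans (le_sum _ (fun j => cnorm (a i j)) j _) _ => [l|]; first exact: cnorm_ge0.
  by apply: le_sum => l; apply: sumr_ge0 => ? _; exact: cnorm_ge0.
have lL : `|u i `^ (- q) - g (u i) - (v j `^ (- q) - g (v j))| <= 2 * L * s.
  apply: le_trans (ler_normB _ _) _.
  have uL : ln (u i) <= L.
    by apply: le_trans (le_sum _ _ i lnu0) _; rewrite lerDl sumr_ge0.
  have vL : ln (v j) <= L.
    by apply: le_trans (le_sum _ _ j lnv0) _; rewrite lerDr sumr_ge0.
  rewrite mulrC mulrA mulr_natr mulr2n mulrDl; apply: lerD.
    by apply: le_trans (gE _ (u1 i)) _; apply: ler_wpM2l => //; apply: ltW.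
  by apply: le_trans (gE _ (v1 j)) _; apply: ler_wpM2l => //; apply: ltW.
apply: le_trans (ler_pM _ _ lL aS) _ => //; first exact: cnorm_ge0.
by rewrite mulrAC.
Qed.

End DyadicPowers.

(** * Decomposition by the signs of the eigenvalues *)

Section SignBlocks.
Variables (I : finType) (lam : I -> R) (q L : R).
Implicit Types (a : I -> I -> R[i]) (M : R).
Hypotheses (q0 : 0 < q) (L0 : 0 < L) (lamL : forall i, lam i = 0 \/ L <= `|lam i|).

Let f i := abs_neg_power q (lam i).
(** The value [L] at a zero eigenvalue is a placeholder that keeps [u] at least [L] everywhere; the
    blocks estimated through [u] contain no zero eigenvalue. *)
Let u i := if lam i == 0 then L else `|lam i|.
Let Lq := L `^ (- q).

Let uL i : L <= u i.
Proof.
rewrite /u; case: (lamL i) => [->|h]; first by rewrite eqxx.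
by case: ifP => // _.
Qed.

Let fE i : lam i != 0 -> f i = u i `^ (- q).
Proof. by move=> h; rewrite /f /abs_neg_power /u (negbTE h). Qed.

Let upow_le i : `|u i `^ (- q)| <= Lq.
Proof.
rewrite ger0_norm ?powR_ge0 // /Lq !powRN lef_pV2 ?posrE ?powR_gt0 //.
  by apply: ge0_ler_powR; rewrite ?nnegrE ?(ltW q0) ?(ltW L0) // (le_trans (ltW L0)).
exact: lt_le_trans L0 (uL i).
Qed.

Let sgn1 (b : bool) : `|b%:R : R| <= 1.
Proof. by case: b; rewrite ?normr1 ?normr0. Qed.

Let restrict (v w : I -> bool) a M : 0 <= M -> form_le a M ->
  form_le (kmul (fun i j => (v i)%:R * (w j)%:R) a) M.
Proof.
move=> M0 aM; rewrite -[M]mul1r -[1 * M]mul1r mulrA.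
by apply: schur_rank1 => // i; exact: sgn1.
Qed.

(** The bound for values at least 1 is applied to u / L; scaling back gives the factor L^(-q) /
    L. *)
Let same_sign_bound a M : 0 <= M -> form_le (kmul (fun i j => u i - u j) a) M ->
  form_le (kmul (fun i j => u i `^ (- q) - u j `^ (- q)) a) (q * (Lq / L * M)).
Proof.
move=> M0 aM.
have u1 i : 1 <= u i / L by rewrite ler_pdivlMr // mul1r.
have /(powR_schur_lipschitz u1 u1 (ltW q0)) : 0 <= M / L by rewrite divr_ge0 // ltW.
move=> /(_ a) /(_ _)/(form_leZ Lq) h.
have -> : q * (Lq / L * M) = `|Lq| * (q * (M / L)).
  by rewrite ger0_norm ?powR_ge0 //; ring.
apply: eq_form_le (h _) => [i j|].
  rewrite /kmul mulrA -rmorphM; congr (_%:C * _).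
  rewrite mulrBr /Lq -!powRM ?divr_ge0 ?(ltW L0) ?(le_trans (ltW L0) (uL _)) //.
  by rewrite ![L * _]mulrC !divfK // gt_eqF.
rewrite [M / L]mulrC -[X in form_le _ (X * _)]ger0_norm ?invr_ge0 ?(ltW L0) //.
apply: eq_form_le (form_leZ L^-1 aM) => i j.
by rewrite /kmul mulrA -rmorphM; congr (_%:C * _); ring.
Qed.

Let opposite_sign_bound a M : 0 <= M ->
  form_le (kmul (fun i j => u i + u j) a) M ->
  form_le (kmul (fun i j => u i `^ (- q) - u j `^ (- q)) a) (Lq / L * M).
Proof.
move=> M0 aM.
have hs := schur_inv_sum L0 uL uL.
have L2 : 0 <= (2 * L)^-1 by rewrite invr_ge0 mulr_ge0 // ltW.
have Lq0 : 0 <= Lq by exact: powR_ge0.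
have s1 : schur (fun i j : I => u i `^ (- q) * 1) (Lq * 1).
  by apply: schur_rank1 => // ?; rewrite normr1.
have s2 : schur (fun i j : I => (-1) * u j `^ (- q)) (1 * Lq).
  by apply: schur_rank1 => // ?; rewrite normrN1.
have := schurM L2 hs (schurD s1 s2).
move=> /(_ _ _ M0 aM); rewrite mulr1 mul1r.
have -> : (Lq + Lq) / (2 * L) * M = Lq / L * M.
  by field; rewrite gt_eqF.
apply: eq_form_le => i j; rewrite /kmul mulrA -rmorphM; congr (_%:C * _).
field; rewrite gt_eqF //.
by rewrite (lt_le_trans L0) // (le_trans (uL i)) // lerDl (le_trans (ltW L0)).
Qed.

Let quotient_le i : `|f i / lam i| <= Lq / L.
Proof.
have [h|h] := eqVneq (lam i) 0.
  by rewrite h invr0 mulr0 normr0 divr_ge0 ?powR_ge0 // ltW.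
rewrite normrM normfV fE //; apply: ler_pM; rewrite ?invr_ge0 //.
rewrite lef_pV2 ?posrE ?normr_gt0 //.
by case: (lamL i) => // h'; rewrite h' eqxx in h.
Qed.

Let quotientK i : f i / lam i * lam i = f i.
Proof.
have [h|h] := eqVneq (lam i) 0; last by rewrite divfK.
by rewrite h mulr0 /f /abs_neg_power h eqxx.
Qed.

(** This serves the block where [lam j] is 0: the divided difference becomes f(lam_i) / lam_i, a
    function of one index. For [lam i = 0] it is 0 by the convention on inverses, in agreement with
    f(0) = 0. *)
Let kernel_bound_row a M : 0 <= M -> form_le (kmul (fun i j => lam i) a) M ->
  form_le (kmul (fun i j => f i) a) (Lq / L * M).
Proof.
move=> M0 aM.
have s : schur (fun i j : I => (f i / lam i) * 1) (Lq / L * 1).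
  apply: schur_rank1 => // [|i]; rewrite ?normr1 //.
  by rewrite divr_ge0 ?powR_ge0 // ltW.
have := s _ _ M0 aM; rewrite mulr1; apply: eq_form_le => i j.
by rewrite /kmul mulrA -rmorphM mulr1 quotientK.
Qed.

Let kernel_bound_col a M : 0 <= M -> form_le (kmul (fun i j => - lam j) a) M ->
  form_le (kmul (fun i j => - f j) a) (Lq / L * M).
Proof.
move=> M0 aM.
have s : schur (fun i j : I => 1 * (f j / lam j)) (1 * (Lq / L)).
  apply: schur_rank1 => // [|i]; rewrite ?normr1 //.
  by rewrite divr_ge0 ?powR_ge0 // ltW.
have := s _ _ M0 aM; rewrite mul1r; apply: eq_form_le => i j.
by rewrite /kmul mulrA -rmorphM mul1r mulrN quotientK.
Qed.

(** Restriction to a block is a Schur multiplier of norm at most 1. On each block [lam i - lam j]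
    is, up to sign, a difference or sum of moduli or a single eigenvalue; the block where both
    eigenvalues vanish contributes nothing. *)
Lemma abs_neg_power_schur_lipschitz a M : 0 <= M ->
  form_le (kmul (fun i j => lam i - lam j) a) M ->
  form_le (kmul (fun i j => f i - f j) a) ((2 * q + 4) * (Lq / L * M)).
Proof.
move=> M0 aM; set K := Lq / L * M.
pose blk (v w : I -> bool) := kmul (fun i j => (v i)%:R * (w j)%:R) a.
have blkM (v w : I -> bool) (phi : I -> I -> R) :
    (forall i j, v i -> w j -> phi i j = lam i - lam j) ->
    form_le (kmul phi (blk v w)) M.
  move=> phiE; apply: eq_form_le (restrict v w M0 aM) => i j.
  rewrite /blk /kmul !mulrA -!rmorphM; congr (_%:C * _).
  case: (boolP (v i)) => [vi|_]; last by rewrite !mul0r mulr0.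
  case: (boolP (w j)) => [wj|_]; last by rewrite mulr0 mul0r mulr0.
  by rewrite phiE // mulrC.
have blkM_opp (v w : I -> bool) (phi : I -> I -> R) :
    (forall i j, v i -> w j -> phi i j = - (lam i - lam j)) ->
    form_le (kmul phi (blk v w)) M.
  move=> phiE; have := form_leZ (-1) (blkM v w (fun i j => - phi i j) _).
  rewrite normrN1 mul1r => h; apply: eq_form_le (h _) => [i j|i j vi wj].
    by rewrite /kmul mulrA -rmorphM mulN1r opprK.
  by rewrite phiE // opprK.
pose p i := 0 < lam i; pose n i := lam i < 0; pose z i := lam i == 0.
have up i : p i -> u i = lam i.
  by rewrite /p /u; case: eqP => [->|_]; rewrite ?ltxx // => /gtr0_norm.
have un i : n i -> u i = - lam i.
  by rewrite /n /u; case: eqP => [->|_]; rewrite ?ltxx // => /ltr0_norm.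
have T1 : form_le (kmul (fun i j => u i `^ (- q) - u j `^ (- q)) (blk p p)) (q * K).
  by apply: same_sign_bound => //; apply: blkM => i j /up -> /up ->.
have T2 : form_le (kmul (fun i j => u i `^ (- q) - u j `^ (- q)) (blk n n)) (q * K).
  apply: same_sign_bound => //; apply: blkM_opp => i j /un -> /un ->; ring.
have T3 : form_le (kmul (fun i j => u i `^ (- q) - u j `^ (- q)) (blk p n)) K.
  by apply: opposite_sign_bound => //; apply: blkM => i j /up -> /un ->.
have T4 : form_le (kmul (fun i j => u i `^ (- q) - u j `^ (- q)) (blk n p)) K.
  apply: opposite_sign_bound => //; apply: blkM_opp => i j /un -> /up ->; ring.
have T5 : form_le (kmul (fun i j => f i) (blk (predC z) z)) K.
  by apply: kernel_bound_row => //; apply: blkM => i j _ /eqP ->; rewrite subr0.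
have T6 : form_le (kmul (fun i j => - f j) (blk z (predC z))) K.
  by apply: kernel_bound_col => //; apply: blkM => i j /eqP -> _; rewrite sub0r.
(* Two blocks of equal signs at q K each, two of opposite signs and two with one zero eigenvalue at
   K each. *)
have -> : (2 * q + 4) * K = q * K + (q * K + (K + (K + (K + K)))) by ring.
apply: eq_form_le (form_leD T1 (form_leD T2 (form_leD T3 (form_leD T4
  (form_leD T5 T6))))) => i j.
rewrite /blk /kmul !mulrA -!rmorphM -!mulrDl -!rmorphD; congr (_%:C * _).
rewrite /p /n /z /=.
have f0 k : lam k = 0 -> f k = 0 by rewrite /f /abs_neg_power => ->; rewrite eqxx.
case: (ltgtP (lam i) 0) => [hi|hi|hi]; case: (ltgtP (lam j) 0) => [hj|hj|hj];
  rewrite ?(fE (ltr0_neq0 hi)) ?(fE (lt0r_neq0 hi)) ?(fE (ltr0_neq0 hj))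
    ?(fE (lt0r_neq0 hj)) ?(f0 _ hi) ?(f0 _ hj) /=; ring.
Qed.

End SignBlocks.

End SchurPower.

(** * Hilbert space preliminaries *)

Section InnerProduct.
Variables (R : realType) (H : hilbertType R).
Implicit Types (x y z : H) (c : R[i]).

Lemma dotDl x y z : <|x + y, z|> = <|x, z|> + <|y, z|>.
Proof. exact: linearDl. Qed.

Lemma dotDr x y z : <|x, y + z|> = <|x, y|> + <|x, z|>.
Proof. exact: linearDr. Qed.

Lemma dotZl c x y : <|c *: x, y|> = c * <|x, y|>.
Proof. exact: linearZl_LR. Qed.

Lemma dotZr c x y : <|x, c *: y|> = Num.conj c * <|x, y|>.
Proof. exact: linearZr_LR. Qed.

Lemma dot_conj x y : <|x, y|> = Num.conj <|y, x|>.
Proof. by rewrite hermC expr0 mul1r. Qed.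

Lemma dotNl x y : <|- x, y|> = - <|x, y|>.
Proof. exact: linearNl. Qed.

Lemma dotNr x y : <|x, - y|> = - <|x, y|>.
Proof. exact: linearNr. Qed.

Lemma dotBl x y z : <|x - y, z|> = <|x, z|> - <|y, z|>.
Proof. exact: linearBl. Qed.

Lemma dotBr x y z : <|x, y - z|> = <|x, y|> - <|x, z|>.
Proof. exact: linearBr. Qed.

Lemma dot0l x : <|0, x|> = 0.
Proof. exact: linear0l. Qed.

Lemma dot0r x : <|x, 0|> = 0.
Proof. exact: linear0r. Qed.

Lemma dot_suml I (r : seq I) (P : pred I) (F : I -> H) x :
  <|\sum_(i <- r | P i) F i, x|> = \sum_(i <- r | P i) <|F i, x|>.
Proof. exact: linear_sumlz. Qed.

Lemma dot_sumr I (r : seq I) (P : pred I) (F : I -> H) x :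
  <|x, \sum_(i <- r | P i) F i|> = \sum_(i <- r | P i) <|x, F i|>.
Proof. exact: linear_sumr. Qed.

Lemma hnormE x : `|x| = (hnorm x)%:C.
Proof. by rewrite /hnorm RRe_real // normr_real. Qed.

Lemma hnorm_ge0 x : 0 <= hnorm x.
Proof. by rewrite -lecR -hnormE normr_ge0. Qed.

Lemma dotE x : <|x, x|> = (hnorm x ^+ 2)%:C.
Proof. by rewrite -dotp_norm hnormE rmorphXn. Qed.

Lemma ler_hnormD x y : hnorm (x + y) <= hnorm x + hnorm y.
Proof. by rewrite -lecR rmorphD /= -!hnormE ler_normD. Qed.

Lemma hnormZ c x : hnorm (c *: x) = cnorm c * hnorm x.
Proof. by apply: complexI; rewrite rmorphM /= -!hnormE normrZ cnormE. Qed.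

Lemma hnorm_opp x : hnorm (- x) = hnorm x.
Proof. by rewrite /hnorm normrN. Qed.

Lemma hnorm_distC x y : hnorm (x - y) = hnorm (y - x).
Proof. by rewrite -hnorm_opp opprB. Qed.

Lemma hnorm0 : hnorm (0 : H) = 0.
Proof. by rewrite /hnorm normr0. Qed.

Lemma hnorm_eq0 x : (hnorm x == 0) = (x == 0).
Proof. by rewrite -(inj_eq (@complexI R)) -hnormE normr_eq0. Qed.

Lemma hnorm_triangle x y z : hnorm (x - z) <= hnorm (x - y) + hnorm (y - z).
Proof. by rewrite -[x - z](subrKA y) ler_hnormD. Qed.

Lemma hnormD_orth x y : <|x, y|> = 0 -> hnorm (x + y) ^+ 2 = hnorm x ^+ 2 + hnorm y ^+ 2.
Proof.
move=> xy; apply: complexI; rewrite rmorphD /= -!dotE dotDl !dotDr xy.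
by rewrite (dot_conj y x) xy conjC0 addr0 add0r.
Qed.

Lemma cauchy_schwarz x y : cnorm <|x, y|> <= hnorm x * hnorm y.
Proof.
have [->|y0] := eqVneq y 0; first by rewrite dot0r cnorm0 hnorm0 mulr0.
have ny : 0 < hnorm y by rewrite lt_neqAle hnorm_ge0 andbT eq_sym hnorm_eq0.
pose c := <|x, y|> / <|y, y|>.
have yy : <|y, y|> != 0.
  by rewrite dotE -[0]/(0%:C) (inj_eq (@complexI R)) expf_neq0 // gt_eqF.
have h : <|x - c *: y, c *: y|> = 0.
  by rewrite dotZr dotBl dotZl /c divfK // subrr mulr0.
have := hnormD_orth h; rewrite subrK => e.
have : hnorm (c *: y) <= hnorm x.
  rewrite -ler_sqr ?nnegrE ?hnorm_ge0 // e lerDr; exact: sqr_ge0.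
rewrite hnormZ => /(ler_wpM2r (hnorm_ge0 y)); apply: le_trans.
rewrite le_eqVlt; apply/orP; left; apply/eqP.
rewrite -mulrA -expr2 -[in RHS](ger0_norm (exprn_ge0 2 (hnorm_ge0 y))) -cnormC -cnormM -dotE.
by rewrite /c divfK.
Qed.

Lemma dot_eq0_all x : (forall y, <|x, y|> = 0) -> x = 0.
Proof.
move=> /(_ x); rewrite dotE => /complexI /eqP.
by rewrite sqrf_eq0 hnorm_eq0 => /eqP.
Qed.

(** Polarization in scalar form: [b1] and [b2] stand for b(x, y) and b(y, x), and the hypotheses
    come from the multiples 1 and i of a vector. *)
Lemma polar_eq0 (b1 b2 : R[i]) :
  b1 + b2 = 0 -> Num.conj 'i%C * b1 + 'i%C * b2 = 0 -> b1 = 0.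
Proof.
move=> e1 e2; have b2E : b2 = - b1 by apply/eqP; rewrite -addr_eq0 addrC e1.
move: e2; rewrite b2E mulrN -mulrBl => /eqP; rewrite mulf_eq0 => /orP[|/eqP//].
rewrite eq_complex /= => /andP[_]; rewrite -opprD oppr_eq0.
by rewrite (_ : 1 + 1 = 2%:R) ?pnatr_eq0 // -natrD.
Qed.

Lemma hnorm_le_dot x (c : R) : 0 <= c ->
  (forall y, cnorm <|x, y|> <= c * hnorm y) -> hnorm x <= c.
Proof.
move=> c0 /(_ x); rewrite dotE cnormC ger0_norm ?sqr_ge0 // expr2.
have [->|nx] := eqVneq (hnorm x) 0; first by [].
by rewrite ler_pM2r // lt_neqAle eq_sym nx hnorm_ge0.
Qed.

Section Orthonormal.
Variables (n : nat) (v : 'I_n -> H).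
Definition orthonormal_family := forall i k, <|v i, v k|> = (i == k)%:R.
Hypothesis ov : orthonormal_family.

Lemma dot_comb (c : 'I_n -> R[i]) k : <|\sum_i c i *: v i, v k|> = c k.
Proof.
rewrite dot_suml (bigD1 k) //= dotZl ov eqxx mulr1 big1 ?addr0 // => i ik.
by rewrite dotZl ov (negbTE ik) mulr0.
Qed.

Lemma hnorm_comb (c : 'I_n -> R[i]) : hnorm (\sum_i c i *: v i) ^+ 2 = \sum_i cnorm (c i) ^+ 2.
Proof.
apply: complexI; rewrite -dotE dot_sumr rmorph_sum; apply: eq_bigr => i _ /=.
by rewrite dotZr dot_comb cnorm_sqr mulrC.
Qed.

End Orthonormal.

End InnerProduct.

Section Topology.
Variables (R : realType) (H : hilbertType R).
Implicit Types (x y z : H).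

Lemma ball_hnorm x (e : R[i]) y : ball x e y <-> `|x - y| < e.
Proof. by rewrite -ball_normE. Qed.

Lemma cvg_hnorm (u : nat -> H) x : u @ \oo --> x ->
  forall e : R, 0 < e -> exists N, forall n, (N <= n)%N -> hnorm (u n - x) < e.
Proof.
move=> /cvgrPdist_lt ux e e0.
have /ux[N _ uN] : 0 < e%:C by rewrite ltcR.
exists N => n Nn; have := uN n Nn.
by rewrite /= hnormE ltcR hnorm_distC.
Qed.

Lemma dense_hnorm (S : set H) : dense S ->
  forall x (e : R), 0 < e -> exists2 y, S y & hnorm (y - x) < e.
Proof.
move=> dS x e e0.
have e0' : 0 < e%:C by rewrite ltcR.
have [||y [xy Sy]] := dS (ball x e%:C).
- by exists x; apply: ballxx.
- exact: ball_open.
exists y => //.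
by move: xy => /ball_hnorm; rewrite hnormE ltcR hnorm_distC.
Qed.

Lemma hnorm_small (x : H) : (forall e : R, 0 < e -> hnorm x < e) -> x = 0.
Proof.
move=> h; apply/eqP; rewrite -hnorm_eq0; apply/negPn/negP => nx.
have : 0 < hnorm x by rewrite lt_neqAle eq_sym nx hnorm_ge0.
by move=> /h; rewrite ltxx.
Qed.

Lemma dense_dot_eq0 (S : set H) x : dense S -> (forall y, S y -> <|x, y|> = 0) -> x = 0.
Proof.
move=> dS xS; apply: hnorm_small => e e0.
have [y Sy yx] := dense_hnorm dS x e0.
have [->|nx] := eqVneq (hnorm x) 0; first by [].
apply: le_lt_trans yx; rewrite hnorm_distC.
have : 0 < hnorm x by rewrite lt_neqAle eq_sym nx hnorm_ge0.
move=> /ler_pM2l <-; apply: le_trans (cauchy_schwarz _ _).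
by rewrite dotBr (xS _ Sy) subr0 dotE cnormC ger0_norm ?sqr_ge0.
Qed.

(** Finite nets, with centres anywhere in [H], are easy to add, to map by bounded operators and to
    use for counting orthonormal vectors. *)
Definition tot_bounded (A : set H) := forall e : R, 0 < e ->
  exists s : seq H, forall x, A x -> exists2 y, y \in s & hnorm (x - y) < e.

Lemma precompact_tot_bounded A : precompact A -> tot_bounded A.
Proof.
rewrite precompactE compact_cover => cA e e0.
have e0' : 0 < e%:C by rewrite ltcR.
have [||D _ AD] := cA H setT (fun x => ball x e%:C).
- by move=> x _; exact: ball_open.
- by move=> x _; exists x => //; exact: ballxx.
exists (finmap.enum_fset D) => x /(@subset_closure _ _ _) /AD[y Dy xy].
exists y => //.
by move: xy => /ball_hnorm; rewrite hnormE ltcR hnorm_distC.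
Qed.

Lemma ultra_big (T : choiceType) (F : set_system H) (s : seq T) (B : T -> set H) :
  UltraFilter F -> F [set x | exists2 i, i \in s & B i x] ->
  exists i, F (B i).
Proof.
move=> UF; elim: s => [|i s ih] Fs.
  have : F set0 by apply: filterS Fs => x [].
  by move=> /filter_not_empty.
have [FB|FnB] := in_ultra_setVsetC (B i) UF; first by exists i.
apply: ih; apply: filterS (filterI Fs FnB) => x [[j]].
by rewrite inE => /orP[/eqP -> Bi /(_ Bi)//|js Bj _]; exists j.
Qed.

Lemma tot_bounded_precompact A : tot_bounded A -> precompact A.
Proof.
move=> tA; rewrite precompactE compact_ultra => F UF FA.
have cF : cauchy_ex F.
  move=> e e0; pose r := complex.Re e / 2.
  have re : (complex.Re e)%:C = e.
    by rewrite RRe_real // gtr0_real.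
  have re0 : 0 < complex.Re e by rewrite -ltcR re.
  have r0 : 0 < r by rewrite divr_gt0.
  have [s sA] := tA r r0.
  (* The net covers only [A]; a point of the closure costs another r / 2, which still leaves the
     radius below 2 r, the real part of [e]. *)
  have [y Fy] : exists y, F [set x | hnorm (x - y) <= r + r / 2].
    apply: (@ultra_big _ F s (fun y => [set x | hnorm (x - y) <= r + r / 2]) UF).
    apply: filterS FA => x.
    have r20 : 0 < (r / 2)%:C by rewrite ltcR divr_gt0.
    move=> /(_ _ (nbhsx_ballx x _ r20)) [z [Az /ball_hnorm]].
    rewrite hnormE ltcR => xz; have [y ys zy] := sA z Az.
    exists y => //=; apply: le_trans (hnorm_triangle _ z _) _.
    by rewrite addrC lerD // ltW.
  exists y; apply: filterS Fy => x /= xy; apply/ball_hnorm.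
  rewrite hnormE -re ltcR hnorm_distC; apply: le_lt_trans xy _.
  rewrite /r; lra.
have /cauchy_cvgP : cauchy F by exact: cauchy_exP.
move=> /cvg_ex[p Fp]; exists p; split=> //.
have /closure_id -> := @closed_closure _ A.
move=> B /Fp FB; have [x [Ax Bx]] := filter_ex (filterI FA FB).
by exists x.
Qed.

End Topology.

Section FiniteDimension.
Variables (R : realType) (H : hilbertType R).
Implicit Types (x y z : H) (V A B : set H).

Lemma lin0 (T : H -> H) : linear T -> T 0 = 0.
Proof. by move=> lT; have := lT (-1) 0 0; rewrite scaler0 addr0 scaleN1r addNr. Qed.

Lemma linD (T : H -> H) : linear T -> {morph T : x y / x + y}.
Proof. by move=> lT x y; have := lT 1 x y; rewrite !scale1r. Qed.

Lemma linZ (T : H -> H) : linear T -> forall c, {morph T : x / c *: x}.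
Proof. by move=> lT c x; have := lT c x 0; rewrite (lin0 lT) !addr0. Qed.

Lemma linN (T : H -> H) : linear T -> {morph T : x / - x}.
Proof. by move=> lT x; rewrite -[in LHS]scaleN1r (linZ lT) scaleN1r. Qed.

Lemma linB (T : H -> H) : linear T -> {morph T : x y / x - y}.
Proof. by move=> lT x y; rewrite (linD lT) (linN lT). Qed.

Lemma lin_sum (T : H -> H) I (r : seq I) (P : pred I) (F : I -> H) : linear T ->
  T (\sum_(i <- r | P i) F i) = \sum_(i <- r | P i) T (F i).
Proof. move=> lT; exact: (big_morph T (linD lT) (lin0 lT)). Qed.

Lemma bounded_op_comp (S S' : H -> H) : bounded_op S -> bounded_op S' ->
  bounded_op (fun x => S (S' x)).
Proof.
move=> [lS [K SK]] [lS' [K' SK']]; split; first by move=> c x y; rewrite lS' lS.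
exists (`|K| * K') => x; apply: le_trans (SK _) _.
apply: le_trans (_ : `|K| * hnorm (S' x) <= _).
  by apply: ler_wpM2r; [exact: hnorm_ge0|exact: ler_norm].
by rewrite -mulrA; apply: ler_wpM2l.
Qed.

Definition linear_subspace V := V 0 /\ forall c x y, V x -> V y -> V (c *: x + y).

Lemma linear_subspace_sum V I (r : seq I) (P : pred I) (F : I -> H) : linear_subspace V ->
  (forall i, P i -> V (F i)) -> V (\sum_(i <- r | P i) F i).
Proof.
move=> [V0 VD] VF; elim/big_ind: _ => // x y Vx Vy.
by have := VD 1 x y Vx Vy; rewrite scale1r.
Qed.

Lemma linear_subspaceZ V c x : linear_subspace V -> V x -> V (c *: x).
Proof. by move=> [V0 VD] Vx; have := VD c x 0 Vx V0; rewrite addr0. Qed.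

Lemma linear_subspaceB V x y : linear_subspace V -> V x -> V y -> V (x - y).
Proof. by move=> [V0 VD] Vx Vy; have := VD (-1) y x Vy Vx; rewrite scaleN1r addrC. Qed.

Definition orthonormal_basis V n (v : 'I_n -> H) :=
  [/\ orthonormal_family v, forall i, V (v i) &
      forall x, V x -> x = \sum_i <|x, v i|> *: v i].

(** A family of maximal size is a basis, because a nonzero remainder of some vector of [V],
    normalized, would extend it. *)
Lemma orthonormal_basis_exists V N : linear_subspace V ->
  (forall n (v : 'I_n -> H), orthonormal_family v -> (forall i, V (v i)) -> (n <= N)%N) ->
  exists n (v : 'I_n -> H), orthonormal_basis V v.
Proof.
move=> sV bound.
pose P n := `[< exists v : 'I_n -> H, orthonormal_family v /\ forall i, V (v i) >].
have P0 : exists n, P n.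
  by exists 0%N; apply/asboolP; exists (fun=> 0); split=> -[].
have PN n : P n -> (n <= N)%N by move=> /asboolP[v [ov Vv]]; exact: bound ov Vv.
case: (ex_maxnP P0 PN) => n /asboolP[v [ov Vv]] nmax.
exists n, v; split=> // x Vx; apply/eqP; rewrite -subr_eq0; apply/negPn/negP.
set r := x - _ => r0.
have rv k : <|r, v k|> = 0.
  by rewrite dotBl (dot_comb ov (fun i => <|x, v i|>)) subrr.
have Vr : V r.
  by apply: linear_subspaceB => //; apply: linear_subspace_sum => // i _; exact: linear_subspaceZ.
have nr : hnorm r != 0 by rewrite hnorm_eq0.
pose e := (hnorm r)^-1%:C *: r.
have ev k : <|e, v k|> = 0 by rewrite dotZl rv mulr0.
have ee : <|e, e|> = 1.
  rewrite dotZl dotZr dotE conjC_real -!rmorphM /= (_ : _ * _ = 1) //.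
  by rewrite expr2; field.
pose w (i : 'I_n.+1) := if unlift ord_max i is Some j then v j else e.
suff : P n.+1 by move=> /nmax; rewrite ltnn.
apply/asboolP; exists w; split.
  move=> i k; rewrite /w; case: unliftP => [i' ->|->]; case: unliftP => [k' ->|->].
  - by rewrite ov (inj_eq lift_inj).
  - by rewrite dot_conj ev conjC0 eq_sym eq_liftF.
  - by rewrite ev eq_liftF.
  - by rewrite ee eqxx.
by move=> i; rewrite /w; case: unliftP => // _; exact: linear_subspaceZ.
Qed.

Lemma orthonormal_hnorm n (v : 'I_n -> H) i : orthonormal_family v -> hnorm (v i) = 1.
Proof.
move=> /(_ i i); rewrite eqxx dotE => /complexI /eqP.
by rewrite -[1]/(1%:R) sqrp_eq1 ?hnorm_ge0 // => /eqP.
Qed.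

Lemma orthonormal_dist n (v : 'I_n -> H) i k : orthonormal_family v -> i != k ->
  1 < hnorm (v i - v k).
Proof.
move=> ov ik.
have h2 : hnorm (v i - v k) ^+ 2 = 2.
  rewrite hnormD_orth; last by rewrite dotNr ov (negbTE ik) oppr0.
  rewrite hnorm_opp; apply: complexI; rewrite rmorphD /= -!dotE !ov !eqxx.
  by rewrite -natrD rmorph_nat.
by rewrite -(@ltr_pXn2r _ 2) ?nnegrE ?hnorm_ge0 // expr1n h2 ltr1n.
Qed.

(** Orthonormal vectors lie at distance sqrt 2 > 1 from each other, so no point of a net of radius
    1/2 serves two of them. *)
Lemma tot_bounded_orthonormal A : tot_bounded A ->
  exists N, forall n (v : 'I_n -> H), orthonormal_family v -> (forall i, A (v i)) -> (n <= N)%N.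
Proof.
move=> tA; have [|s sA] := tA (1 / 2); first by rewrite divr_gt0.
exists (size s) => n v ov Av.
have /choice[g gE] : forall i, exists y, y \in s /\ hnorm (v i - y) < 1 / 2.
  by move=> i; have [y ys vy] := sA _ (Av i); exists y.
have g_inj : injective g.
  move=> i k gik; apply/eqP/negPn/negP => ik.
  have := orthonormal_dist ov ik; apply/negP; rewrite -leNgt.
  apply: le_trans (hnorm_triangle _ (g i) _) _.
  have := (gE i).2; have := (gE k).2; rewrite -gik (hnorm_distC (v k)); lra.
rewrite -[n]card_ord -(size_codom g) uniq_leq_size //.
  by rewrite map_inj_uniq ?enum_uniq.
by move=> y /codomP[i ->]; exact: (gE i).1.
Qed.

Lemma tot_boundedS A B : A `<=` B -> tot_bounded B -> tot_bounded A.
Proof. by move=> AB tB e e0; have [s sB] := tB e e0; exists s => x /AB /sB. Qed.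

Lemma tot_boundedD A B : tot_bounded A -> tot_bounded B ->
  tot_bounded [set x + y | x in A & y in B].
Proof.
move=> tA tB e e0; have e20 : 0 < e / 2 by rewrite divr_gt0.
have [s sA] := tA _ e20; have [t tB'] := tB _ e20.
exists [seq x + y | x <- s, y <- t] => _ [x Ax] [y By] <-.
have [x' x's xx'] := sA x Ax; have [y' y't yy'] := tB' y By.
exists (x' + y'); first by apply/allpairsP; exists (x', y').
rewrite opprD addrACA; apply: le_lt_trans (ler_hnormD _ _) _.
by rewrite [e in ltRHS]splitr ltrD.
Qed.

Lemma tot_bounded_image A (T : H -> H) : bounded_op T -> tot_bounded A ->
  tot_bounded (T @` A).
Proof.
move=> [lT [M TM]] tA e e0.
have M0 : 0 < `|M| + 1 by rewrite ltr_wpDl.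
have [|s sA] := tA (e / (`|M| + 1)); first by rewrite divr_gt0.
exists (map T s) => _ [x Ax <-]; have [y ys xy] := sA x Ax.
exists (T y); first exact: map_f.
rewrite -(linB lT); apply: le_lt_trans (TM _) _.
apply: le_lt_trans (_ : (`|M| + 1) * hnorm (x - y) < _).
  apply: ler_wpM2r; first exact: hnorm_ge0.
  by apply: le_trans (ler_norm _) _; rewrite lerDl.
by rewrite mulrC -ltr_pdivlMr.
Qed.

(** Linearity and symmetry are asked on [V] only, since [T] will be the unbounded D on a spectral
    subspace. The coordinates of T (v j) form the j-th row of [A], hence the rows of the unitary
    matrix give the eigenvectors. *)
Lemma diagonalization V n (v : 'I_n -> H) (T : H -> H) : linear_subspace V ->
  orthonormal_basis V v ->
  (forall x, V x -> V (T x)) ->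
  (forall c x y, V x -> V y -> T (c *: x + y) = c *: T x + T y) ->
  (forall x y, V x -> V y -> <|T x, y|> = <|x, T y|>) ->
  exists (e : 'I_n -> H) (lam : 'I_n -> R), orthonormal_basis V e /\
    forall i, T (e i) = (lam i)%:C *: e i.
Proof.
move=> sV [ov Vv vV] VT lT symT.
have V0 := sV.1.
pose A : 'M[R[i]]_n := \matrix_(j, k) <|T (v j), v k|>.
have hA : A \is hermsymmx.
  apply/is_hermitianmxP; rewrite expr0 scale1r; apply/matrixP => j k.
  by rewrite !mxE symT // dot_conj.
have /orthomx_spectralP AE := hermitian_normalmx hA.
set U := spectralmx A in AE; set d := spectral_diag A in AE.
have uU : U \is unitarymx by exact: spectral_unitarymx.
have UA : U *m A = diag_mx d *m U.
  by rewrite AE !mulmxA mulmxV ?spectral_unit // mul1mx.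
pose e i := \sum_j U i j *: v j.
have Ve i : V (e i) by apply: linear_subspace_sum => // j _; exact: linear_subspaceZ.
have T0 : T 0 = 0.
  by have := lT (-1) 0 0 V0 V0; rewrite scaler0 addr0 scaleN1r addNr.
have Tsum (c : 'I_n -> R[i]) : T (\sum_j c j *: v j) = \sum_j c j *: T (v j).
  suff : V (\sum_j c j *: v j) /\ T (\sum_j c j *: v j) = \sum_j c j *: T (v j) by case.
  elim/big_ind2: _ => [//|x' x y' y [Vx Ex] [Vy Ey]|j _].
    split; first by have := sV.2 1 x y Vx Vy; rewrite scale1r.
    by have := lT 1 x y Vx Vy; rewrite !scale1r Ex Ey.
  split; first exact: linear_subspaceZ.
  by have := lT (c j) (v j) 0 (Vv j) V0; rewrite T0 !addr0.
have Te i : T (e i) = d 0 i *: e i.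
  have TvE j : T (v j) = \sum_k A j k *: v k.
    rewrite [LHS]vV; last exact: VT.
    by apply: eq_bigr => k _; rewrite mxE.
  rewrite Tsum (eq_bigr (fun j => \sum_k (U i j * A j k) *: v k)); last first.
    by move=> j _; rewrite TvE scaler_sumr; apply: eq_bigr => k _; rewrite scalerA.
  rewrite exchange_big scaler_sumr /=; apply: eq_bigr => k _.
  have /matrixP/(_ i k) := UA; rewrite !mxE => UAE.
  rewrite -scaler_suml UAE scalerA; congr (_ *: _).
  rewrite (bigD1 i) //= big1 ?addr0; first by rewrite !mxE eqxx mulr1n.
  by move=> j ji; rewrite !mxE eq_sym (negbTE ji) mulr0n mul0r.
have UU : U *m (map_mx Num.conj U^T) = 1%:M by apply/unitarymxP.
have oe : orthonormal_family e.
  move=> i k; have /matrixP/(_ i k) := UU; rewrite !mxE => <-.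
  rewrite /e dot_sumr; apply: eq_bigr => j _.
  by rewrite dotZr (dot_comb ov) !mxE mulrC.
have UU' : (map_mx Num.conj U^T) *m U = 1%:M by apply: mulmx1C.
(* Taking real parts loses nothing: symmetry tested on the unit vector [e i] shows that [d 0 i] is
   real. *)
exists e, (fun i => complex.Re (d 0 i)); split; last first.
  move=> i; rewrite Te; congr (_ *: _); rewrite RRe_real //.
  apply/CrealP.
  have := symT (e i) (e i) (Ve i) (Ve i).
  by rewrite !Te dotZl dotZr oe eqxx !mulr1 => /esym.
split=> // x Vx.
have vE j : v j = \sum_i Num.conj (U i j) *: e i.
  rewrite /e; under eq_bigr => i _ do rewrite scaler_sumr.
  rewrite exchange_big /= (bigD1 j) //=.
  have UUE k : \sum_i Num.conj (U i j) * U i k = (j == k)%:R.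
    have /matrixP/(_ j k) := UU'; rewrite !mxE => <-.
    by apply: eq_bigr => i _; rewrite !mxE.
  rewrite [X in _ + X]big1 ?addr0; last first.
    move=> k kj; under eq_bigr => i _ do rewrite scalerA.
    by rewrite -scaler_suml UUE eq_sym (negbTE kj) scale0r.
  under eq_bigr => i _ do rewrite scalerA.
  by rewrite -scaler_suml UUE eqxx scale1r.
rewrite {1}[x]vV //.
under eq_bigr => j _ do rewrite {2}[v j]vE scaler_sumr.
rewrite exchange_big /=; apply: eq_bigr => i _.
under eq_bigr => j _ do rewrite scalerA.
rewrite -scaler_suml; congr (_ *: _).
rewrite /e dot_sumr; apply: eq_bigr => j _.
by rewrite dotZr mulrC.
Qed.

End FiniteDimension.

(** * Projection-valued measures and spectral integrals *)

Section ProjectionValuedMeasure.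
Variables (R : realType) (H : hilbertType R).
Local Notation MT := (measurableTypeR R).
Variable E : set MT -> H -> H.
Hypothesis hE : is_pvm E.
Implicit Types (A B : set MT) (x y : H).

Lemma pvm_linear B : measurable B -> linear (E B).
Proof. by move=> mB; exact: (pvm_bounded hE mB).1. Qed.

(** The series for the constant sequence [set0] converges, so its terms, all equal to this vector,
    tend to 0. *)
Lemma pvm_set0 x : E set0 x = 0.
Proof.
apply: hnorm_small => e e0.
have := @pvm_sigma _ _ _ hE (fun=> set0) (fun _ => measurable0) (@trivIset_set0 _ _ setT) x.
rewrite bigcup0 // => /cvg_hnorm /(_ (e / 2)) [|N hN]; first by rewrite divr_gt0.
have := hN N.+1 (leqnSn N); have := hN N (leqnn N).
rewrite /series /= big_nat_recr //=.
set S := \sum_(0 <= k < N) _; move=> h1 h2.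
have -> : E set0 x = (S + E set0 x - E set0 x) - (S - E set0 x).
  by rewrite addrK opprB addrC subrK.
apply: le_lt_trans (ler_hnormD _ _) _; rewrite hnorm_opp [e]splitr; exact: ltrD.
Qed.

Lemma pvmU A B x : measurable A -> measurable B -> A `&` B = set0 ->
  E (A `|` B) x = E A x + E B x.
Proof.
move=> mA mB AB; apply/eqP; rewrite eq_sym -subr_eq0; apply/eqP.
apply: hnorm_small => e e0.
have mF n : measurable (bigcup2 A B n).
  by case: n => [|[|n]]; rewrite /bigcup2 //=; exact: measurable0.
have := @pvm_sigma _ _ _ hE _ mF; rewrite -trivIset_bigcup2 => /(_ AB x).
rewrite bigcup2E => /cvg_hnorm /(_ e e0) [N /(_ N.+2)]; rewrite (leq_trans (leqnSn N)) //.
move=> /(_ isT); rewrite /series /= !big_nat_recl // big1_seq ?addr0 //.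
by move=> i _; rewrite /bigcup2 /= pvm_set0.
Qed.

Lemma pvm_split B x : measurable B -> x = E B x + E (~` B) x.
Proof.
move=> mB; rewrite -pvmU //; [|exact: measurableC|exact: setICr].
by rewrite setUv (pvm_setT hE).
Qed.

Lemma pvmI A B x : measurable A -> measurable B -> E A (E B x) = E (A `&` B) x.
Proof. by move=> mA mB; rewrite (pvm_setI hE). Qed.

Lemma pvm_idem B x : measurable B -> E B (E B x) = E B x.
Proof. by move=> mB; rewrite pvmI // setIid. Qed.

Lemma pvm_orth A B x y : measurable A -> measurable B -> A `&` B = set0 ->
  <|E A x, E B y|> = 0.
Proof. by move=> mA mB AB; rewrite (pvm_selfadj hE) // pvmI // AB pvm_set0 dot0r. Qed.

Lemma pvm_dot B x : measurable B -> <|E B x, x|> = (hnorm (E B x) ^+ 2)%:C.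
Proof. by move=> mB; rewrite -dotE -[in LHS](pvm_idem x mB) (pvm_selfadj hE). Qed.

Lemma hnorm_pvm_split B x : measurable B ->
  hnorm x ^+ 2 = hnorm (E B x) ^+ 2 + hnorm (E (~` B) x) ^+ 2.
Proof.
move=> mB; rewrite {1}(pvm_split x mB) hnormD_orth //.
by apply: pvm_orth; [|exact: measurableC|exact: setICr].
Qed.

Lemma hnorm_pvm B x : measurable B -> hnorm (E B x) <= hnorm x.
Proof.
move=> mB; rewrite -ler_sqr ?nnegrE ?hnorm_ge0 // (hnorm_pvm_split x mB) lerDl.
exact: sqr_ge0.
Qed.

Let mu x := pvm_measure E x.

Let mu0 x : mu x set0 = 0%E.
Proof. by rewrite /mu /pvm_measure pvm_set0 hnorm0 expr0n. Qed.

Let mu_ge0 x A : (0 <= mu x A)%E.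
Proof. by rewrite /mu /pvm_measure lee_fin sqr_ge0. Qed.

Let mu_sigma x : semi_sigma_additive (mu x).
Proof.
move=> F mF tF mUF.
pose s n := \sum_(0 <= i < n) E (F i) x.
have dot_s n : <|s n, x|> = (\sum_(0 <= i < n) hnorm (E (F i) x) ^+ 2)%:C.
  rewrite /s dot_suml rmorph_sum; apply: eq_bigr => i _.
  by rewrite pvm_dot.
have -> : (fun n => (\sum_(0 <= i < n) mu x (F i))%E) =
    (fun n => (complex.Re <|s n, x|>)%:E).
  by apply/funext => n; rewrite dot_s /= -sumEFin.
apply: cvg_EFin; first by near=> n.
have := @pvm_sigma _ _ _ hE _ mF tF x => /cvg_hnorm sx.
apply/cvgrPdist_lt => e e0.
have M0 : 0 < hnorm x + 1 by rewrite ltr_wpDl ?hnorm_ge0.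
have [|N hN] := sx (e / (hnorm x + 1)); first by rewrite divr_gt0.
exists N => // n Nn /=.
have -> : hnorm (E (\bigcup_n F n) x) ^+ 2 - complex.Re <|s n, x|> =
    complex.Re <|E (\bigcup_n F n) x - s n, x|>.
  by rewrite dotBl raddfB pvm_dot.
have : `|<|E (\bigcup_n F n) x - s n, x|>| <= (hnorm (E (\bigcup_n F n) x - s n) * hnorm x)%:C.
  by rewrite cnormE lecR cauchy_schwarz.
move=> /(le_trans (normc_ge_Re _)); rewrite lecR => /le_lt_trans; apply.
rewrite hnorm_distC.
apply: le_lt_trans (_ : hnorm (s n - E (\bigcup_n F n) x) * (hnorm x + 1) < _).
  by apply: ler_wpM2l; rewrite ?hnorm_ge0 // lerDl.
by rewrite -ltr_pdivlMr //; exact: hN.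
Unshelve. all: by end_near. Qed.

(* The unused argument lets instance inference find the proof that E is a PVM. *)
Definition spectral_measure (_ : is_pvm E) x : set MT -> \bar R := mu x.

HB.instance Definition _ x := isMeasure.Build _ MT R (spectral_measure hE x)
  (mu0 x) (@mu_ge0 x) (@mu_sigma x).

Let mu_fin x : fin_num_fun (spectral_measure hE x).
Proof. by move=> A mA. Qed.

HB.instance Definition _ x := @Measure_isFinite.Build _ MT R
  (spectral_measure hE x) (mu_fin x).

End ProjectionValuedMeasure.

(** * Quadratic forms of symmetric operators *)

Section Polarization.
Variables (R : realType) (H : hilbertType R) (V : set H).
Hypothesis sV : linear_subspace V.

Lemma polarization (b : H -> H -> R[i]) :
  (forall c x y z, V x -> V y -> V z -> b (c *: x + y) z = c * b x z + b y z) ->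
  (forall c x y z, V x -> V y -> V z -> b z (c *: x + y) = Num.conj c * b z x + b z y) ->
  (forall x, V x -> b x x = 0) -> forall x y, V x -> V y -> b x y = 0.
Proof.
move=> bl br b0 x y Vx Vy; have [V0 VD] := sV.
have Vc c : V (c *: y + x) by exact: VD.
have key c : Num.conj c * b x y + c * b y x = 0.
  have := b0 _ (Vc c).
  rewrite (bl c y x _ Vy Vx (Vc c)) (br c y x y Vy Vx Vy) (br c y x x Vy Vx Vx).
  by rewrite (b0 _ Vy) (b0 _ Vx) mulr0 add0r addr0 addrC.
apply: polar_eq0 (key _); have := key 1.
by rewrite conjC1 !mul1r.
Qed.

Variable T : H -> H.
Hypotheses (VT : forall x, V x -> V (T x))
  (lT : forall c x y, V x -> V y -> T (c *: x + y) = c *: T x + T y)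
  (symT : forall x y, V x -> V y -> <|T x, y|> = <|x, T y|>).

(** For symmetric operators the numerical radius controls the norm: <T x, y> is recovered from the
    quadratic form at x + y and x - y, and the parallelogram law bounds the sum of their squared
    norms. *)
Lemma symmetric_bound (K : R) : 0 <= K ->
  (forall x, V x -> cnorm <|T x, x|> <= K * hnorm x ^+ 2) ->
  forall x, V x -> hnorm (T x) <= K * hnorm x.
Proof.
move=> K0 TK x Vx; have [V0 VD] := sV.
have VB u w : V u -> V w -> V (u - w) by exact: linear_subspaceB.
have VA u w : V u -> V w -> V (u + w).
  by move=> Vu Vw; have := VD 1 u w Vu Vw; rewrite scale1r.
have TA u w : V u -> V w -> T (u + w) = T u + T w.
  by move=> Vu Vw; have := lT 1 Vu Vw; rewrite !scale1r.
have TB u w : V u -> V w -> T (u - w) = T u - T w.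
  by move=> Vu Vw; rewrite addrC -scaleN1r lT // scaleN1r addrC.
have [->|Tx0] := eqVneq (T x) 0; first by rewrite hnorm0 mulr_ge0 // hnorm_ge0.
have nT : 0 < hnorm (T x) by rewrite lt_neqAle eq_sym hnorm_eq0 Tx0 hnorm_ge0.
(* [t] makes y = t T x as long as x, so that <T x, y> = |x| |T x|. *)
pose t := hnorm x / hnorm (T x).
have t0 : 0 <= t by rewrite divr_ge0 ?hnorm_ge0.
pose y := t%:C *: T x.
have Vy : V y by apply: (linear_subspaceZ _ sV); exact: VT.
have yx : hnorm y = hnorm x.
  by rewrite hnormZ cnormC ger0_norm // divfK // gt_eqF.
have e1 : <|T (x + y), x + y|> - <|T (x - y), x - y|> = (4 * (t * hnorm (T x) ^+ 2))%:C.
  rewrite TA // TB // !dotDl !dotDr !dotNl !dotNr.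
  rewrite [<|T y, x|>]symT // [<|y, T x|>]dotZl [<|T x, y|>]dotZr conjC_real dotE; ring.
have par : hnorm (x + y) ^+ 2 + hnorm (x - y) ^+ 2 = 4 * hnorm x ^+ 2.
  apply: complexI; rewrite rmorphD /= -!dotE.
  rewrite !dotDl !dotDr !dotNl !dotNr [<|y, y|>]dotE yx dotE; ring.
have : 4 * (t * hnorm (T x) ^+ 2) <= K * (4 * hnorm x ^+ 2).
  have -> : 4 * (t * hnorm (T x) ^+ 2) = cnorm (4 * (t * hnorm (T x) ^+ 2))%:C.
    by rewrite cnormC ger0_norm // mulr_ge0 // mulr_ge0 // sqr_ge0.
  rewrite -e1 -par mulrDr; apply: le_trans (cnormD _ _) _; rewrite cnormN.
  by apply: lerD; apply: TK; [apply: VA|apply: VB].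
rewrite [leRHS]mulrCA ler_pM2l // /t [in leLHS]expr2 mulrA divfK ?gt_eqF //.
have [x0|x0] := eqVneq (hnorm x) 0.
  have x0' : x = 0 by apply/eqP; rewrite -hnorm_eq0 x0.
  have : T x = 0.
    by have := lT (-1) V0 V0; rewrite x0' scaler0 addr0 scaleN1r addNr.
  by move=> T0; rewrite T0 eqxx in Tx0.
rewrite expr2 mulrCA ler_pM2l // lt_neqAle eq_sym x0 hnorm_ge0 //.
Qed.

End Polarization.

Lemma norm_le_1sqr (R : realType) (r : R) : `|r| <= 1 + r ^+ 2.
Proof.
rewrite -(real_normK (num_real r)).
have := sqr_ge0 (`|r| - 1); have := normr_ge0 r; nra.
Qed.

(** * Spectral integrals and spectral subspaces *)

Section SpectralIntegral.
Variables (R : realType) (H : hilbertType R).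
Local Notation MT := (measurableTypeR R).
Variable E : set MT -> H -> H.
Hypothesis hE : is_pvm E.
Implicit Types (A B : set MT) (x y : H).
Local Notation mu x := (spectral_measure hE x).

Lemma spectral_measureE x A : mu x A = (hnorm (E A x) ^+ 2)%:E.
Proof. by []. Qed.

Lemma spectral_measure_split B x A : measurable B -> measurable A ->
  mu x A = measure_add (mu (E B x)) (mu (E (~` B) x)) A.
Proof.
move=> mB mA; have mC := measurableC mB.
rewrite measure_addE /= /spectral_measure /pvm_measure -EFinD; congr _%:E.
rewrite {1}(pvm_split hE x mB) (linD (pvm_linear hE mA)) hnormD_orth //.
rewrite !(pvmI hE) //; apply: (pvm_orth hE); try exact: measurableI.
by rewrite setIACA setIid setICr setI0.
Qed.

Lemma ge0_spectral_integral_split B x (g : MT -> \bar R) :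
  measurable B -> (forall l, 0 <= g l)%E -> measurable_fun [set: MT] g ->
  (\int[mu x]_l g l = \int[mu (E B x)]_l g l + \int[mu (E (~` B) x)]_l g l)%E.
Proof.
move=> mB g0 mg; rewrite -ge0_integral_measure_add //.
by apply: eq_measure_integral => A mA _; exact: spectral_measure_split.
Qed.

Lemma ge0_spectral_integral_le B x (g : MT -> \bar R) (K : R) :
  measurable B -> (forall l, 0 <= g l)%E -> measurable_fun [set: MT] g ->
  E B x = x -> (forall l, B l -> g l <= K%:E)%E ->
  (\int[mu x]_l g l <= (K * hnorm x ^+ 2)%:E)%E.
Proof.
move=> mB g0 mg Bx gK; have mC := measurableC mB.
have C0 : mu x (~` B) = 0%E.
  by rewrite spectral_measureE -Bx (pvmI hE) // setICl (pvm_set0 hE) hnorm0 expr0n.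
rewrite (ge0_negligible_integral mC) // setTD setCK.
apply: le_trans (_ : \int[mu x]_(l in B) (cst K%:E) l <= _)%E.
  apply: ge0_le_integral => //; first exact: measurable_funS mg.
by rewrite integral_cst //= /spectral_measure /pvm_measure Bx EFinM.
Qed.

Variables (f : R -> R) (P : operator H).
Hypothesis mf : measurable_fun (setT : set MT) (f : MT -> MT).
Hypothesis hP : is_spectral_integral E f P.

Let linP : linear_op P. Proof. by case: hP. Qed.

Let msq : measurable_fun (setT : set MT) (fun l : MT => ((f l ^+ 2)%:E : \bar R)).
Proof. by apply/measurable_EFinP; exact: measurable_funX. Qed.

Lemma spectral_domP x : dom P x <-> (\int[mu x]_l (f l ^+ 2)%:E < +oo)%E.
Proof. by case: hP => _ + _; apply. Qed.

Lemma spectral_dotE x : dom P x ->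
  <|P x, x|> = (fine (\int[mu x]_l (f l)%:E))%:C.
Proof. by case: hP => _ _; apply. Qed.

(** The spectral measure of [x] is finite, so square-integrability, which is what the domain
    records, implies integrability. *)
Lemma spectral_integrable x : dom P x -> (mu x).-integrable setT (EFin \o f).
Proof.
move=> /spectral_domP fx.
have i1 : (mu x).-integrable setT (EFin \o cst (1 : R)).
  exact: finite_measure_integrable_cst.
have i2 : (mu x).-integrable setT (fun l => (f l ^+ 2)%:E).
  apply/integrableP; split=> //.
  by under eq_integral => l _ do rewrite gee0_abs ?lee_fin ?sqr_ge0 //.
apply: le_integrable (integrableD measurableT i1 i2) => //.
  exact/measurable_EFinP.
move=> l _; rewrite /= lee_fin [leRHS]ger0_norm ?addr_ge0 ?sqr_ge0 //.
exact: norm_le_1sqr.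
Qed.

Lemma spectral_dom_pvm B x : measurable B -> dom P x -> dom P (E B x).
Proof.
move=> mB /spectral_domP fx; apply/spectral_domP; apply: le_lt_trans fx.
rewrite (ge0_spectral_integral_split x mB) ?leeDl //.
  by apply: integral_ge0 => l _; rewrite lee_fin sqr_ge0.
by move=> l; rewrite lee_fin sqr_ge0.
Qed.

Lemma spectral_dot_split B x : measurable B -> dom P x ->
  <|P x, x|> = <|P (E B x), E B x|> + <|P (E (~` B) x), E (~` B) x|>.
Proof.
move=> mB Px; have mC := measurableC mB.
have d1 := spectral_dom_pvm mB Px; have d2 := spectral_dom_pvm mC Px.
have i1 := spectral_integrable d1; have i2 := spectral_integrable d2.
rewrite !spectral_dotE // -rmorphD -fineD ?integrable_fin_num //; congr (fine _)%:C.
rewrite -(integral_measure_add measurableT i1 i2).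
by apply: eq_measure_integral => A mA _; exact: spectral_measure_split.
Qed.

Lemma spectral_dom_lin c x y : dom P x -> dom P y -> dom P (c *: x + y).
Proof. by move=> Px Py; have [] := linP.2 c x y Px Py. Qed.

Lemma spectral_lin c x y : dom P x -> dom P y -> P (c *: x + y) = c *: P x + P y.
Proof. by move=> Px Py; have [] := linP.2 c x y Px Py. Qed.

Lemma spectral_domZ c x : dom P x -> dom P (c *: x).
Proof. by move=> Px; rewrite -[_ *: _]addr0; exact: (spectral_dom_lin _ Px linP.1). Qed.

Lemma spectral0 : P 0 = 0.
Proof.
by have := spectral_lin (-1) linP.1 linP.1; rewrite scaler0 addr0 scaleN1r addNr.
Qed.

Lemma spectralZ c x : dom P x -> P (c *: x) = c *: P x.
Proof. by move=> Px; have := spectral_lin c Px linP.1; rewrite spectral0 !addr0. Qed.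

Lemma spectralD x y : dom P x -> dom P y -> P (x + y) = P x + P y.
Proof. by move=> Px Py; have := spectral_lin 1 Px Py; rewrite !scale1r. Qed.

Lemma spectral_domD x y : dom P x -> dom P y -> dom P (x + y).
Proof. by move=> Px Py; have := spectral_dom_lin 1 Px Py; rewrite scale1r. Qed.

(* Splitting x = E(B) x + E(~B) x leaves no cross terms in <P x, x>; polarization
   then gives that P preserves the range of E(B). *)
Lemma spectral_cross_eq0 B x y : measurable B -> dom P x -> dom P y ->
  <|P (E B x), E (~` B) y|> = 0.
Proof.
move=> mB Px Py; have mC := measurableC mB.
set u := E B x.
have du : dom P u by exact: spectral_dom_pvm.
have EBu : E B u = u by exact: pvm_idem.
have ECu : E (~` B) u = 0 by rewrite /u pvmI // setICl (pvm_set0 hE).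
have key w : dom P w -> E (~` B) w = w -> <|P u, w|> + <|P w, u|> = 0.
  move=> dw Cw.
  have Bw : E B w = 0 by rewrite -Cw (pvmI hE) // setICr (pvm_set0 hE).
  have := spectral_dot_split mB (spectral_domD du dw).
  rewrite !(linD (pvm_linear hE _)) // EBu ECu Bw Cw addr0 add0r.
  rewrite spectralD // dotDl !dotDr => /eqP.
  rewrite -subr_eq0 => /eqP <-; ring.
set w := E (~` B) y.
have dw : dom P w by exact: spectral_dom_pvm.
have Cw : E (~` B) w = w by exact: pvm_idem.
apply: polar_eq0 (key w dw Cw) _.
have := key ('i%C *: w) (spectral_domZ _ dw).
by rewrite (linZ (pvm_linear hE mC)) Cw spectralZ // dotZl dotZr; apply.
Qed.

Hypothesis densP : dense (dom P).

(** Density turns the vanishing cross terms into invariance of the ranges of E(B) and of E(~B) under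
    P. *)
Lemma spectral_pvm_comm B x : measurable B -> dom P x -> P (E B x) = E B (P x).
Proof.
move=> mB Px; have mC := measurableC mB.
have inv A : measurable A -> E (~` A) (P (E A x)) = 0.
  move=> mA; apply: (dense_dot_eq0 densP) => y Py.
  by rewrite (pvm_selfadj hE) ?spectral_cross_eq0 //; exact: measurableC.
have := inv _ mC; rewrite setCK => invC.
have d1 := spectral_dom_pvm mB Px; have d2 := spectral_dom_pvm mC Px.
rewrite {2}(pvm_split hE x mB) spectralD // (linD (pvm_linear hE mB)) invC addr0.
by rewrite {1}(pvm_split hE (P (E B x)) mB) inv // addr0.
Qed.

Lemma spectral_bounded B (K : R) x : measurable B -> 0 <= K ->
  (forall l, B l -> `|f l| <= K) -> E B x = x ->
  dom P x /\ cnorm <|P x, x|> <= K * hnorm x ^+ 2.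
Proof.
move=> mB K0 fK Bx.
have Px : dom P x.
  apply/spectral_domP.
  apply: le_lt_trans (ge0_spectral_integral_le (K := K ^+ 2) mB _ _ Bx _) _ => //.
  - by move=> l; rewrite lee_fin sqr_ge0.
  - move=> l Bl; rewrite lee_fin -(real_normK (num_real (f l))).
    by apply: lerXn2r; rewrite ?nnegrE //; exact: fK.
  - exact: ltry.
split=> //; rewrite spectral_dotE // cnormC.
have ifx := spectral_integrable Px.
rewrite -lee_fin -abse_EFin fineK ?integrable_fin_num //.
have mEf : measurable_fun [set: MT] (EFin \o f) by exact/measurable_EFinP.
apply: le_trans (le_abse_integral _ measurableT mEf) _.
apply: ge0_spectral_integral_le mB _ _ Bx _ => //.
exact: measurableT_comp.
Qed.

Lemma linear_subspace_dom : linear_subspace (dom P).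
Proof. by split; [exact: linP.1|move=> c x y; exact: spectral_dom_lin]. Qed.

Lemma linear_subspace_pvm B : measurable B -> linear_subspace [set x | E B x = x].
Proof.
move=> mB; split=> [|c x y /= Bx By]; first exact: lin0 (pvm_linear hE mB).
by rewrite (pvm_linear hE mB) Bx By.
Qed.

Lemma spectral_symmetric x y : dom P x -> dom P y -> <|P x, y|> = <|x, P y|>.
Proof.
move=> Px Py; apply/eqP; rewrite -subr_eq0; apply/eqP.
apply: (polarization linear_subspace_dom (b := fun x y => <|P x, y|> - <|x, P y|>)) => //.
- move=> c u v w Pu Pv Pw; rewrite spectral_lin // !dotDl !dotZl; ring.
- move=> c u v w Pu Pv Pw; rewrite spectral_lin // !dotDr !dotZr; ring.
- by move=> u Pu; rewrite (dot_conj u) spectral_dotE // conjC_real subrr.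
Qed.

(** On the range of E(B) the quadratic form of P - c vanishes, and polarization removes the operator
    itself. As P x - c x stays in that range, it need only be tested against vectors of the
    range. *)
Lemma spectral_const B (c : R) x : measurable B -> (forall l, B l -> f l = c) ->
  E B x = x -> P x = c%:C *: x.
Proof.
move=> mB fc Bx; have mC := measurableC mB.
have VP y : E B y = y -> dom P y.
  move=> By; apply: (spectral_bounded (K := `|c|) mB _ _ By).1 => // l Bl.
  by rewrite fc.
have cst_form y : E B y = y -> <|P y, y|> = (c * hnorm y ^+ 2)%:C.
  move=> By; rewrite spectral_dotE; last exact: VP.
  have -> : (\int[mu y]_l (f l)%:E = \int[mu y]_l (cst c%:E l))%E.
    apply: ae_eq_integral => //; first exact/measurable_EFinP.
    exists (~` B); split=> //.
      rewrite /= /spectral_measure /pvm_measure -By (pvmI hE) // setICl.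
      by rewrite (pvm_set0 hE) hnorm0 expr0n.
    move=> l /= h Bl; apply: h => _; by rewrite fc.
  by rewrite integral_cst //= /spectral_measure /pvm_measure (pvm_setT hE).
have sB := linear_subspace_pvm mB.
apply/eqP; rewrite -subr_eq0; apply/eqP/dot_eq0_all => y.
have -> : <|P x - c%:C *: x, y|> = <|P x - c%:C *: x, E B y|>.
  rewrite -(pvm_selfadj hE) // (linB (pvm_linear hE mB)) (linZ (pvm_linear hE mB)) Bx.
  by rewrite -spectral_pvm_comm ?Bx //; exact: VP.
apply: (polarization sB (b := fun x y => <|P x - c%:C *: x, y|>)) => //.
- move=> k u v w /= Bu Bv Bw; rewrite spectral_lin ?dotBl ?dotDl ?dotZl; try exact: VP.
  by rewrite !dotDl !dotZl; ring.
- by move=> k u v w /= Bu Bv Bw; rewrite dotDr dotZr.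
- move=> u /= Bu; rewrite dotBl cst_form // dotZl dotE rmorphM /=; exact: subrr.
- exact: pvm_idem.
Qed.

(** The eigenvector equation makes the integral of f - c against the measure of [x] vanish. On [B],
    which carries that measure, f - c has constant sign [s] and no zero, so the measure is 0. *)
Lemma spectral_support B (s c : R) x : measurable B ->
  (forall l, B l -> f l != c /\ `|f l - c| = s * (f l - c)) ->
  E B x = x -> dom P x -> P x = c%:C *: x -> x = 0.
Proof.
move=> mB fB Bx Px Pxc; have mC := measurableC mB.
have ifx := spectral_integrable Px.
have icx : (mu x).-integrable setT (EFin \o cst c).
  exact: finite_measure_integrable_cst.
have int0 : (\int[mu x]_l ((f l)%:E - (cst c l)%:E) = 0)%E.
  have ci : (\int[mu x]_l (cst c l)%:E = (c * hnorm x ^+ 2)%:E)%E.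
    rewrite (_ : \int[mu x]_l _ = \int[mu x]_l cst c%:E l)%E //.
    by rewrite integral_cst //= /spectral_measure /pvm_measure (pvm_setT hE).
  rewrite integralB_EFin // ci -[X in (X - _)%E]fineK ?integrable_fin_num //.
  have := spectral_dotE Px; rewrite Pxc dotZl dotE -rmorphM => /complexI <-.
  by rewrite -EFinB subrr.
have C0 : mu x (~` B) = 0%E.
  by rewrite /spectral_measure /pvm_measure -Bx (pvmI hE) // setICl (pvm_set0 hE) hnorm0 expr0n.
have mfc : measurable_fun [set: MT] (fun l => ((f l)%:E - (cst c l)%:E)%E).
  by apply: emeasurable_funB; exact/measurable_EFinP.
have abs0 : (\int[mu x]_l `|(f l)%:E - (cst c l)%:E| = 0)%E.
  have -> : (\int[mu x]_l `|(f l)%:E - (cst c l)%:E| =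
      \int[mu x]_l (s%:E * ((f l)%:E - (cst c l)%:E)))%E.
    apply: ae_eq_integral => //.
    - exact: measurableT_comp.
    - exact: measurable_funeM.
    exists (~` B); split=> // l /= h Bl; apply: h => _.
    by rewrite -EFinB /= (fB l Bl).2.
  rewrite integralZl //; first by rewrite int0 mule0.
  exact: integrableB.
have /ae_eq_integral_abs : measurable_fun [set: MT] (fun l => ((f l)%:E - (cst c l)%:E)%E) by [].
move=> /(_ (mu x) measurableT)[/(_ abs0) [N [mN N0 BN]] _].
have : mu x B = 0%E.
  apply: (subset_measure0 mB mN _ N0) => l Bl; apply: BN => /= h.
  have := h Logic.I; rewrite -EFinB => -[/eqP]; rewrite subr_eq0.
  by apply/negP; exact: (fB l Bl).1.
rewrite /spectral_measure /pvm_measure Bx => -[/eqP].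
by rewrite sqrf_eq0 hnorm_eq0 => /eqP.
Qed.

End SpectralIntegral.

(** * Spectral decomposition of a Dirac operator *)

Section DiscreteSpectrum.
Variables (R : realType) (H : hilbertType R) (D : operator H).
Local Notation MT := (measurableTypeR R).
Variable E : set MT -> H -> H.
Hypotheses (hE : is_pvm E) (hD : is_spectral_integral E id D).
Hypotheses (sD : selfadjoint D) (rD : compact_resolvent D).
Implicit Types (A B : set MT) (x y : H).

Let denseD : dense (dom D). Proof. by case: sD. Qed.

Let mid : measurable_fun [set: MT] (id : MT -> MT).
Proof. exact: measurable_id. Qed.

Definition bounded_by (K : R) B := forall l : R, B l -> `|l| <= K.

Lemma pvm_range_tot_bounded B (K : R) : measurable B -> bounded_by K B ->
  tot_bounded [set x | E B x = x /\ hnorm x <= 1].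
Proof.
move=> mB; wlog K0 : K / 0 <= K => [wl BK|BK].
  apply: (wl `|K|) => // l Bl; apply: le_trans (BK l Bl) (ler_norm _).
have [c [S [[_ _ SD] [linS cS]]]] := rD.
(* Bounds the norm of D x - c x on the unit ball of the range; the 1 makes it invertible. *)
pose r := K + cnorm c + 1.
have r0 : 0 < r by rewrite ltr_wpDl // addr_ge0 // cnorm_ge0.
have scale_bounded : bounded_op (fun x : H => r%:C *: x).
  split; first by move=> k x y; rewrite scalerDr !scalerA mulrC.
  by exists r => x; rewrite hnormZ cnormC gtr0_norm.
apply: tot_boundedS (tot_bounded_image scale_bounded (precompact_tot_bounded cS)).
move=> x [Bx x1].
have V y : E B y = y -> dom D y /\ cnorm <|D y, y|> <= K * hnorm y ^+ 2.
  by move=> By; exact: (spectral_bounded hE mid hD mB K0 BK By).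
have dx := (V x Bx).1.
have Dx : hnorm (D x) <= K * hnorm x.
  apply: (symmetric_bound (linear_subspace_pvm hE mB)) => //.
  - move=> y /= By; rewrite -(spectral_pvm_comm hE mid hD denseD mB (V y By).1).
    by rewrite By.
  - move=> k y z /= By Bz; exact: (spectral_lin hD k (V y By).1 (V z Bz).1).
  - move=> y z /= By Bz; exact: (spectral_symmetric hE hD (V y By).1 (V z Bz).1).
  - by move=> y /V[].
pose z := (r^-1)%:C *: (D x - c *: x).
exists (S z); last first.
  rewrite /z (linZ linS) SD // scalerA -rmorphM mulfV ?gt_eqF //.
  by rewrite scale1r.
exists z => //=; rewrite /z hnormZ cnormC gtr0_norm ?invr_gt0 //.
rewrite mulrC ler_pdivrMr // mul1r.
apply: le_trans (ler_hnormD _ _) _; rewrite hnorm_opp hnormZ.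
have := cnorm_ge0 c; have := hnorm_ge0 x; rewrite /r; nra.
Qed.

(** The half-lines on either side of [lam] are treated separately, because l - lam has a constant
    sign on each. *)
Lemma pvm_eigenvector x (lam : R) : dom D x -> D x = lam%:C *: x ->
  E [set lam] x = x.
Proof.
move=> dx Dx.
have vanish B (s : R) : measurable B ->
    (forall l : R, B l -> l != lam /\ `|l - lam| = s * (l - lam)) -> E B x = 0.
  move=> mB Bs.
  have dB := spectral_dom_pvm hE mid hD mB dx.
  apply: (spectral_support hE mid hD mB Bs _ dB); first exact: pvm_idem.
  by rewrite (spectral_pvm_comm hE mid hD denseD mB dx) Dx (linZ (pvm_linear hE mB)).
have m1 : measurable ([set l : R | lam < l] : set MT).
  by rewrite (_ : [set l : R | lam < l] = `]lam, +oo[%classic) //; apply/seteqP; split=> l /=;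
    rewrite in_itv /= andbT.
have m2 : measurable ([set l : R | l < lam] : set MT).
  by rewrite (_ : [set l : R | l < lam] = `]-oo, lam[%classic) //; apply/seteqP; split=> l /=;
    rewrite in_itv.
have ms : measurable ([set lam] : set MT) by exact: measurable_set1.
rewrite [RHS](pvm_split hE x ms).
have -> : ~` [set lam] = [set l : R | lam < l] `|` [set l : R | l < lam].
  apply/seteqP; split=> l /=.
    by move=> /eqP; case: (ltgtP l lam) => // h _; [right|left].
  by move=> [|] h e; rewrite e ltxx in h.
rewrite (pvmU hE) //; last first.
  by apply/seteqP; split=> l //= [h1 h2]; have := lt_trans h1 h2; rewrite ltxx.
have v1 : E [set l : R | lam < l] x = 0.
  by apply: (vanish _ 1 m1) => l /= h; rewrite mul1r gtr0_norm ?subr_gt0 // gt_eqF.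
have v2 : E [set l : R | l < lam] x = 0.
  by apply: (vanish _ (-1) m2) => l /= h; rewrite mulN1r ltr0_norm ?subr_lt0 // lt_eqF.
by rewrite v1 v2 !addr0.
Qed.

Lemma pvm_eigen_set A x (lam : R) : measurable A -> E [set lam] x = x -> ~ A lam ->
  E A x = 0.
Proof.
move=> mA ex nA; have ms : measurable ([set lam] : set MT) by exact: measurable_set1.
rewrite -ex (pvmI hE _ mA ms) (_ : _ `&` _ = set0) ?(pvm_set0 hE) //.
by apply/seteqP; split=> l //= [Al ll]; apply: nA; rewrite -ll.
Qed.

(** Membership of [e i] in the range of E({lam i}) carries it over to functions of D; membership of
    [lam i] in [B] is what eigenvalue counts and gap conditions use. *)
Lemma pvm_eigenbasis B (K : R) : measurable B -> bounded_by K B ->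
  exists n (e : 'I_n -> H) (lam : 'I_n -> R),
    orthonormal_basis [set x | E B x = x] e /\
    forall i, [/\ dom D (e i), D (e i) = (lam i)%:C *: e i,
                  E [set lam i] (e i) = e i & B (lam i)].
Proof.
move=> mB; wlog K0 : K / 0 <= K => [wl BK|BK].
  apply: (wl `|K|) => // l Bl; apply: le_trans (BK l Bl) (ler_norm _).
have V y : E B y = y -> dom D y.
  by move=> By; exact: (spectral_bounded hE mid hD mB K0 BK By).1.
have [N bound] := tot_bounded_orthonormal (pvm_range_tot_bounded mB BK).
have sV := linear_subspace_pvm hE mB.
have [n [v bv]] : exists n (v : 'I_n -> H), orthonormal_basis [set x | E B x = x] v.
  apply: (orthonormal_basis_exists (N := N) sV) => n v ov Vv.
  by apply: (bound n v ov) => i; split; [exact: Vv|rewrite (orthonormal_hnorm i ov)].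
have [e [lam [be De]]] : exists (e : 'I_n -> H) (lam : 'I_n -> R),
    orthonormal_basis [set x | E B x = x] e /\ forall i, D (e i) = (lam i)%:C *: e i.
  apply: (diagonalization sV bv).
  - move=> y /= By; rewrite -(spectral_pvm_comm hE mid hD denseD mB (V y By)).
    by rewrite By.
  - move=> k y z /= By Bz; exact: (spectral_lin hD k (V y By) (V z Bz)).
  - move=> y z /= By Bz; exact: (spectral_symmetric hE hD (V y By) (V z Bz)).
exists n, e, lam; split=> // i.
have [oe Ve _] := be.
have di := V _ (Ve i).
have Ei := pvm_eigenvector di (De i).
split=> //; apply: contrapT => nB.
have : E B (e i) = 0 by exact: pvm_eigen_set mB Ei nB.
have := Ve i; rewrite /= => -> e0; have := orthonormal_hnorm i oe.
by rewrite e0 hnorm0 => /eqP; rewrite eq_sym oner_eq0.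
Qed.

Lemma measurable_norm_lt (K : R) : measurable ([set l : R | `|l| < K] : set MT).
Proof.
rewrite (_ : [set l : R | `|l| < K] = `]- K, K[%classic) //.
by apply/seteqP; split=> l /=; rewrite in_itv /= ltr_norml.
Qed.

(** The shells n <= |l| < n + 1 partition the line and their partial sums telescope. *)
Lemma pvm_cvg x (e : R) : 0 < e -> exists N, forall n, (N <= n)%N ->
  hnorm (E [set l : R | `|l| < n%:R] x - x) < e.
Proof.
move=> e0.
pose B n : set MT := [set l : R | `|l| < n%:R].
have mB n : measurable (B n) by exact: measurable_norm_lt.
pose F n : set MT := B n.+1 `\` B n.
have mF n : measurable (F n) by exact: measurableD.
have tF : trivIset setT F.
  apply/trivIsetP => i j _ _; wlog ij : i j / (i < j)%N.
    move=> wl; rewrite neq_ltn => /orP[ij|ji]; first by apply: wl => //; rewrite lt_eqF.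
    by rewrite setIC; apply: wl => //; rewrite lt_eqF.
  move=> _; apply/seteqP; split=> l //= [[Bi _] [_ nBj]]; apply: nBj.
  by rewrite /B /=; apply: lt_le_trans Bi _; rewrite ler_nat.
have UF : \bigcup_n F n = setT.
  apply/seteqP; split=> l // _.
  have /andP[h1 h2] := Num.Theory.trunc_itv (normr_ge0 (l : R)).
  by exists (Num.trunc `|l : R|) => //; split=> //=; apply/negP; rewrite -leNgt.
have sF n : series (fun n => E (F n) x) n = E (B n) x.
  rewrite /series /=; elim: n => [|n ih].
    rewrite big_geq // (_ : B 0%N = set0) ?(pvm_set0 hE) //.
    by apply/seteqP; split=> l //=; rewrite /B /= ltNge normr_ge0.
  rewrite big_nat_recr //= ih -(pvmU hE) //.
    congr (E _ x); apply/seteqP; split=> l.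
      by move=> [|[]//]; rewrite /B /= => h; apply: lt_trans h _; rewrite ltr_nat.
    by move=> Bl; case: (pselect (B n l)) => h; [left|right].
  by apply/seteqP; split=> l //= [Bl [_ nBl]].
have := @pvm_sigma _ _ _ hE _ mF tF x.
rewrite UF (pvm_setT hE) => /cvg_hnorm /(_ e e0) [N hN].
by exists N => n Nn; have := hN n Nn; rewrite sF.
Qed.

(** Only finitely many eigenvalues have modulus below 1, so the nonzero ones stay away from 0; this
    is what makes |D|^(-q) bounded. *)
Lemma spectral_gap : exists2 eps : R, 0 < eps &
  forall x, E [set l : R | l = 0 \/ eps <= `|l|] x = x.
Proof.
have mB := measurable_norm_lt 1.
have [|n [e [lam [[oe Ve eB] ee]]]] := pvm_eigenbasis (K := 1) mB.
  by move=> l /= /ltW.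
(* The default value 1 keeps |l| < eps inside |l| < 1, the region described by the eigenbasis. *)
pose eps := \big[Num.min/(1 : R)]_(i < n | lam i != 0) `|lam i|.
have eps0 : 0 < eps.
  rewrite /eps; elim/big_ind: _ => // [u w u0 w0|i]; first by rewrite lt_min u0.
  by rewrite normr_gt0.
have epsi i : lam i != 0 -> eps <= `|lam i|.
  by move=> li; rewrite /eps (bigD1 i) //= ge_min lexx.
have eps1 : eps <= 1.
  by rewrite /eps; elim/big_rec: _ => // i u _ u1; rewrite ge_min u1 orbT.
pose G : set MT := [set l : R | l = 0 \/ eps <= `|l|].
pose G' : set MT := [set l : R | `|l| < eps] `\ 0.
have mG' : measurable G'.
  by apply: measurableD; [exact: measurable_norm_lt|exact: measurable_set1].
have GE : G = ~` G'.
  apply/seteqP; split=> l /=.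
    by move=> [->|h] [/= h1 h2]; [exact: h2|rewrite ltNge h in h1].
  move=> h; case: (eqVneq l 0) => [->|l0]; [by left|right].
  by rewrite leNgt; apply/negP => h1; apply: h; split=> //=; apply/eqP.
exists eps => // x; rewrite -/G GE.
rewrite [RHS](pvm_split hE x mG') (_ : E G' x = 0) ?add0r //.
have -> : E G' x = E G' (E [set l : R | `|l| < 1] x).
  rewrite (pvmI hE) //; congr (E _ x); apply/seteqP; split=> l /=; last by case.
  by move=> [h1 h2]; split=> //; exact: lt_le_trans h1 eps1.
rewrite (eB (E _ x)); last exact: pvm_idem.
rewrite (lin_sum _ _ _ (pvm_linear hE mG')) big1 // => i _.
rewrite (linZ (pvm_linear hE mG')).
have [_ _ Ei _] := ee i.
rewrite (pvm_eigen_set mG' Ei) ?scaler0 // => -[/= h1 h2].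
by have /epsi : lam i != 0 by [apply/eqP]; rewrite leNgt h1.
Qed.

End DiscreteSpectrum.

(** * The commutator *)

Section CommutatorEstimate.
Variables (R : realType) (H : hilbertType R) (D P : operator H) (q : R).
Local Notation MT := (measurableTypeR R).
Variable E : set MT -> H -> H.
Hypotheses (hE : is_pvm E) (hD : is_spectral_integral E id D).
Hypotheses (sD : selfadjoint D) (rD : compact_resolvent D).
Hypotheses (q0 : 0 < q) (hP : is_spectral_integral E (abs_neg_power q) P).
Implicit Types (B : set MT) (x y : H) (L : R).

Lemma abs_neg_powerE (l : R) : abs_neg_power q l = `|l| `^ (- q).
Proof.
rewrite /abs_neg_power; case: eqP => // ->.
by rewrite normr0 powR0 // oppr_eq0 gt_eqF.
Qed.

Lemma measurable_abs_neg_power :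
  measurable_fun [set: MT] (abs_neg_power q : MT -> MT).
Proof.
rewrite (_ : abs_neg_power q = (fun l => l `^ (- q)) \o (fun l : R => `|l|)); last first.
  by apply/funext => l; rewrite abs_neg_powerE.
exact: (measurableT_comp (measurable_powR _) (measurable_funTS (@normr_measurable R setT))).
Qed.

(** Including 0, where the function |l|^(-q) is set to 0, lets [gap_set eps] carry the whole
    spectral measure. *)
Definition gap_set L : set MT := [set l : R | l = 0 \/ L <= `|l|].

Lemma measurable_gap_set L : measurable (gap_set L).
Proof.
rewrite (_ : gap_set L = [set 0] `|` ~` [set l : R | `|l| < L]).
  apply: measurableU; first exact: measurable_set1.
  by apply: measurableC; exact: measurable_norm_lt.
apply/seteqP; split=> l /= [->|h]; [by left|right|by left|right].
  by apply/negP; rewrite -leNgt.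
by rewrite leNgt; apply/negP.
Qed.

Lemma abs_neg_power_gap L l : 0 < L -> gap_set L l -> `|abs_neg_power q l| <= L `^ (- q).
Proof.
move=> L0; rewrite abs_neg_powerE ger0_norm ?powR_ge0 // => -[->|Ll].
  by rewrite normr0 powR0 ?powR_ge0 // oppr_eq0 gt_eqF.
rewrite !powRN lef_pV2 ?posrE ?powR_gt0 //; last exact: lt_le_trans Ll.
by apply: ge0_ler_powR; rewrite ?nnegrE ?(ltW q0) ?(ltW L0).
Qed.

Lemma power_domP x : dom P x.
Proof.
have [eps eps0 Ee] := spectral_gap hE hD sD rD.
apply: (spectral_bounded hE measurable_abs_neg_power hP (measurable_gap_set eps)
  (powR_ge0 eps (- q)) _ (Ee x)).1 => l.
exact: abs_neg_power_gap.
Qed.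

Let denseP : dense (dom P).
Proof. by move=> O [x Ox] _; exists x; split=> //; exact: power_domP. Qed.

Lemma power_linear : linear P.
Proof. move=> c x y; exact: (spectral_lin hP c (power_domP x) (power_domP y)). Qed.

Lemma power_symmetric x y : <|P x, y|> = <|x, P y|>.
Proof. exact: (spectral_symmetric hE hP (power_domP x) (power_domP y)). Qed.

Lemma power_bounded : bounded_op P.
Proof.
have [eps eps0 Ee] := spectral_gap hE hD sD rD.
split; first exact: power_linear.
exists (eps `^ (- q)) => x.
have sT : linear_subspace [set: H] by [].
apply: (symmetric_bound sT) => //.
- by move=> c u v _ _; exact: power_linear.
- by move=> u v _ _; exact: power_symmetric.
- exact: powR_ge0.
- move=> u _; apply: (spectral_bounded hE measurable_abs_neg_power hP
    (measurable_gap_set eps) (powR_ge0 eps (- q)) _ (Ee u)).2 => l.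
  exact: abs_neg_power_gap.
Qed.

Lemma power_eigenvector x (lam : R) : E [set lam] x = x ->
  P x = (abs_neg_power q lam)%:C *: x.
Proof.
move=> ex; have ms : measurable ([set lam] : set MT) by exact: measurable_set1.
by apply: (spectral_const hE measurable_abs_neg_power hP denseP ms _ ex) => l /= ->.
Qed.

Variables (a : H -> H) (delta : R).
Hypotheses (ba : bounded_op a) (adom : forall x, dom D x -> dom D (a x)).
Hypotheses (delta0 : 0 <= delta)
  (hdelta : forall x, dom D x -> hnorm (D (a x) - a (D x)) <= delta * hnorm x).

Let T x := P (a x) - a (P x).

Lemma commutator_bounded : bounded_op T.
Proof.
have [la [M aM]] := ba; have [lP [K PK]] := power_bounded.
split.
  move=> c x y; rewrite /T la lP lP la scalerBr opprD addrACA.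
  by [].
exists (`|K| * `|M| + `|M| * `|K|) => x.
have aM' z : hnorm (a z) <= `|M| * hnorm z.
  by apply: le_trans (aM z) _; rewrite ler_wpM2r ?hnorm_ge0 // ler_norm.
have PK' z : hnorm (P z) <= `|K| * hnorm z.
  by apply: le_trans (PK z) _; rewrite ler_wpM2r ?hnorm_ge0 // ler_norm.
rewrite mulrDl; apply: le_trans (ler_hnormD _ _) _; rewrite hnorm_opp; apply: lerD.
  by apply: le_trans (PK' _) _; rewrite -mulrA ler_wpM2l.
by apply: le_trans (aM' _) _; rewrite -mulrA ler_wpM2l.
Qed.

Let schur_const L := (2 * q + 4) * (L `^ (- q) / L).

Let schur_const_ge0 L : 0 < L -> 0 <= schur_const L.
Proof.
move=> L0; rewrite mulr_ge0 ?divr_ge0 ?powR_ge0 ?(ltW L0) //.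
by rewrite addr_ge0 // mulr_ge0 // ltW.
Qed.

(** The forms of [form_le] are bilinear while the inner product is conjugate-linear on the right,
    hence the conjugates. *)
Let dot_sum_sum n (e : 'I_n -> H) (A : H -> H) (X Y : 'I_n -> R[i]) :
  A (\sum_j Y j *: e j) = \sum_j Y j *: A (e j) ->
  \sum_i \sum_j <|A (e j), e i|> * X i * Y j =
  <|A (\sum_j Y j *: e j), \sum_i Num.conj (X i) *: e i|>.
Proof.
move=> ->; rewrite dot_sumr; apply: eq_bigr => i _.
rewrite dotZr conjCK dot_suml mulr_sumr; apply: eq_bigr => j _.
rewrite dotZl; ring.
Qed.

Let sqn_comb n (e : 'I_n -> H) (Y : 'I_n -> R[i]) : orthonormal_family e ->
  sqn Y = hnorm (\sum_j Y j *: e j) ^+ 2.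
Proof. by move=> oe; rewrite (hnorm_comb oe). Qed.

(** In an eigenbasis with t_ij = <a e_j, e_i>, the entries of [D, a] and T are t_ij times the
    differences of eigenvalues and of their images. [K] provides finite dimension and is absent from
    the bound, so it may tend to infinity. *)
Lemma commutator_form_bounded_range L B (K : R) x y : 0 < L -> measurable B ->
  bounded_by K B -> B `<=` gap_set L -> E B x = x -> E B y = y ->
  cnorm <|T x, y|> <= schur_const L * delta * ((hnorm x ^+ 2 + hnorm y ^+ 2) / 2).
Proof.
move=> L0 mB BK BL Bx By.
have [n [e [lam [[oe Ve eB] ee]]]] := pvm_eigenbasis hE hD sD rD mB BK.
pose X i := Num.conj <|y, e i|>; pose Y i := <|x, e i|>.
have xE : x = \sum_j Y j *: e j by exact: eB.
have yE : y = \sum_i Num.conj (X i) *: e i.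
  by rewrite {1}(eB y By); apply: eq_bigr => i _; rewrite /X conjCK.
have de i : dom D (e i) by have [] := ee i.
have De i : D (e i) = (lam i)%:C *: e i by have [] := ee i.
have Pe i : P (e i) = (abs_neg_power q (lam i))%:C *: e i.
  by have [_ _ h _] := ee i; exact: power_eigenvector.
have lamL i : lam i = 0 \/ L <= `|lam i|.
  by have [_ _ _ /BL] := ee i.
pose t i j := <|a (e j), e i|>.
have la := ba.1.
pose C x := D (a x) - a (D x).
have sym x' y' := @spectral_symmetric _ _ _ hE _ _ hD x' y'.
have Dt i j : kmul (fun i j => lam i - lam j) t i j = <|C (e j), e i|>.
  rewrite /kmul /C /t dotBl sym ?De ?dotZr ?conjC_real //; last exact: adom.
  by rewrite (linZ la) dotZl rmorphB mulrBl.
have Tt i j : kmul (fun i j => abs_neg_power q (lam i) - abs_neg_power q (lam j)) t i j =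
    <|T (e j), e i|>.
  rewrite /kmul /T /t dotBl power_symmetric !Pe dotZr conjC_real.
  by rewrite (linZ la) dotZl rmorphB mulrBl.
have dom_comb (Z : 'I_n -> R[i]) : dom D (\sum_j Z j *: e j).
  apply: linear_subspace_sum => [|j _]; first exact: (linear_subspace_dom hD).
  exact: (linear_subspaceZ _ (linear_subspace_dom hD)).
have D_comb (Z : 'I_n -> R[i]) : D (\sum_j Z j *: e j) = \sum_j Z j *: D (e j).
  suff : dom D (\sum_j Z j *: e j) /\ D (\sum_j Z j *: e j) = \sum_j Z j *: D (e j) by case.
  elim/big_ind2: _ => [|u' u v' v [du Eu] [dv Ev]|j _].
  - by split; [exact: (linear_subspace_dom hD).1|exact: (spectral0 hD)].
  - by split; [exact: (spectral_domD hD)|rewrite (spectralD hD) // Eu Ev].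
  - by split; [exact: (spectral_domZ hD)|exact: (spectralZ hD)].
have C_comb (Z : 'I_n -> R[i]) : C (\sum_j Z j *: e j) = \sum_j Z j *: C (e j).
  have Cs : dom D (a (\sum_j Z j *: e j)) /\
      D (a (\sum_j Z j *: e j)) = \sum_j Z j *: D (a (e j)).
    rewrite (lin_sum _ _ _ la).
    elim/big_ind2: _ => [|u' u v' v [du Eu] [dv Ev]|j _].
    - by split; [exact: (linear_subspace_dom hD).1|exact: (spectral0 hD)].
    - by split; [exact: (spectral_domD hD)|rewrite (spectralD hD) // Eu Ev].
    - rewrite (linZ la); split; [apply: (spectral_domZ hD)|apply: (spectralZ hD)]; exact: adom.
  rewrite /C Cs.2 D_comb (lin_sum _ _ _ la) -sumrB; apply: eq_bigr => j _.
  by rewrite (linZ la) scalerBr.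
have form_C : form_le (kmul (fun i j => lam i - lam j) t) delta.
  move=> X' Y'.
  under eq_bigr => i _ do under eq_bigr => j _ do rewrite Dt.
  rewrite (dot_sum_sum _ (C_comb _)).
  have -> : sqn X' = hnorm (\sum_i Num.conj (X' i) *: e i) ^+ 2.
    rewrite -(sqn_comb _ oe) /sqn; apply: eq_bigr => i _; by rewrite cnorm_conj.
  rewrite (sqn_comb Y' oe); set u := \sum_j _ *: _; set v := \sum_i _ *: _.
  apply: le_trans (cauchy_schwarz _ _) _.
  have Cu : hnorm (C u) <= delta * hnorm u by apply: hdelta; exact: dom_comb.
  apply: le_trans (ler_wpM2r (hnorm_ge0 v) Cu) _; rewrite -mulrA ler_wpM2l //.
  have := sqr_ge0 (hnorm u - hnorm v); nra.
have := abs_neg_power_schur_lipschitz q0 L0 lamL delta0 form_C X Y.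
have T_lin := commutator_bounded.1.
under eq_bigr => i _ do under eq_bigr => j _ do rewrite Tt.
rewrite (dot_sum_sum (A := T)); last first.
  rewrite (lin_sum _ _ _ T_lin); apply: eq_bigr => j _; exact: (linZ T_lin).
rewrite -xE -yE (_ : sqn X = hnorm y ^+ 2); last first.
  rewrite yE -(sqn_comb _ oe) /sqn; apply: eq_bigr => i _; by rewrite cnorm_conj.
rewrite (_ : sqn Y = hnorm x ^+ 2); last by rewrite xE -(sqn_comb _ oe).
move=> h; apply: le_trans h _; rewrite le_eqVlt; apply/orP; left; apply/eqP.
by rewrite /schur_const; ring.
Qed.

Lemma commutator_form_gap L B x y : 0 < L -> measurable B ->
  B `<=` gap_set L -> E B x = x -> E B y = y ->
  cnorm <|T x, y|> <= schur_const L * delta * (hnorm x * hnorm y).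
Proof.
move=> L0 mB BL Bx By.
set M := schur_const L * delta.
have M0 : 0 <= M by rewrite mulr_ge0 ?schur_const_ge0.
have [T_lin [K TK]] := commutator_bounded.
have TK' z : hnorm (T z) <= (`|K| + 1) * hnorm z.
  apply: le_trans (TK z) _; rewrite ler_wpM2r ?hnorm_ge0 //.
  by apply: le_trans (ler_norm _) _; rewrite lerDl.
have K1 : 0 < `|K| + 1 by rewrite ltr_wpDl.
have sB := linear_subspace_pvm hE mB.
(* Truncation to |l| < n keeps the vectors in the range of E(B) and does not increase their norms;
   boundedness of T controls the error. *)
have am u w : E B u = u -> E B w = w ->
    cnorm <|T u, w|> <= M * ((hnorm u ^+ 2 + hnorm w ^+ 2) / 2).
  move=> Bu Bw; apply/ler_addgt0Pr => e e0.
  pose I n : set MT := [set l : R | `|l| < n%:R].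
  have mI n : measurable (I n) by exact: measurable_norm_lt.
  pose r := (`|K| + 1) * (hnorm u + hnorm w) + 1.
  have r0 : 0 < r by rewrite ltr_wpDl // mulr_ge0 ?addr_ge0 ?hnorm_ge0 // ltW.
  have er0 : 0 < e / r by rewrite divr_gt0.
  have [N1 hN1] := pvm_cvg hE u er0; have [N2 hN2] := pvm_cvg hE w er0.
  pose n := maxn N1 N2.
  have {hN1} u_n := hN1 n (leq_maxl _ _); have {hN2} w_n := hN2 n (leq_maxr _ _).
  set u' := E (I n) u in u_n; set w' := E (I n) w in w_n.
  have rangeBI z : E B z = z -> E (B `&` I n) (E (I n) z) = E (I n) z.
    move=> Bz; have mBI := measurableI _ _ mB (mI n).
    rewrite -[in LHS]Bz (pvmI hE _ (mI n) mB) (pvmI hE _ mBI (measurableI _ _ (mI n) mB)).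
    rewrite -[in RHS]Bz (pvmI hE _ (mI n) mB); congr (E _ z).
    by apply/seteqP; split=> l /=; tauto.
  have bI : bounded_by n%:R (B `&` I n) by move=> l [_ /ltW].
  have BIL : B `&` I n `<=` gap_set L by move=> l [/BL].
  have u'u : hnorm u' <= hnorm u by exact: (hnorm_pvm hE _ (mI n)).
  have w'w : hnorm w' <= hnorm w by exact: (hnorm_pvm hE _ (mI n)).
  have := commutator_form_bounded_range L0 (measurableI _ _ mB (mI n)) bI BIL
    (rangeBI u Bu) (rangeBI w Bw).
  rewrite -/u' -/w' -/M => h.
  have -> : <|T u, w|> = <|T u', w'|> - (<|T (u' - u), w|> + <|T u', w' - w|>).
    rewrite (linB T_lin) dotBl dotBr; ring.
  apply: le_trans (cnormD _ _) _; rewrite cnormN; apply: lerD.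
    apply: le_trans h _; apply: ler_wpM2l => //; apply: ler_wpM2r => //.
    by apply: lerD; apply: lerXn2r; rewrite ?nnegrE ?hnorm_ge0.
  apply: le_trans (cnormD _ _) _.
  apply: le_trans (_ : (`|K| + 1) * (hnorm u + hnorm w) * (e / r) <= _); last first.
    rewrite mulrA ler_pdivrMr // [leLHS]mulrC; apply: ler_wpM2l; first exact: ltW.
    by rewrite /r lerDl.
  rewrite mulrDr mulrDl addrC; apply: lerD.
    apply: le_trans (cauchy_schwarz _ _) _; apply: ler_pM; rewrite ?hnorm_ge0 //; last exact: ltW.
    by apply: le_trans (TK' _) _; apply: ler_wpM2l => //; exact: ltW.
  apply: le_trans (cauchy_schwarz _ _) _.
  rewrite -mulrA [hnorm w * _]mulrC mulrA; apply: ler_wpM2r; first exact: hnorm_ge0.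
  by apply: le_trans (TK' _) _; apply: ler_wpM2l; apply: ltW.
have [x0|x0] := eqVneq x 0.
  by rewrite x0 (lin0 T_lin) dot0l cnorm0 hnorm0 mul0r mulr0.
have [y0|y0] := eqVneq y 0.
  by rewrite y0 dot0r cnorm0 hnorm0 !mulr0.
have nx : 0 < hnorm x by rewrite lt_neqAle eq_sym hnorm_eq0 x0 hnorm_ge0.
have ny : 0 < hnorm y by rewrite lt_neqAle eq_sym hnorm_eq0 y0 hnorm_ge0.
(* The rescaled vectors have equal norms, which turns the arithmetic mean into a product. *)
have := am ((hnorm y)%:C *: x) ((hnorm x)%:C *: y).
rewrite !(linZ (pvm_linear hE mB)) Bx By => /(_ erefl erefl).
rewrite (linZ T_lin) dotZl dotZr conjC_real !cnormM !cnormC !hnormZ !cnormC !gtr0_norm //.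
have nxy : 0 < hnorm y * hnorm x by rewrite mulr_gt0.
move=> h; rewrite -(ler_pM2l nxy) -mulrA; apply: le_trans h _.
by rewrite le_eqVlt; apply/orP; left; apply/eqP; field.
Qed.

End CommutatorEstimate.

(** * Singular values *)

Section SingularValues.
Variables (R : realType) (H : hilbertType R).
Implicit Types (T : H -> H) (x y : H).

(* [xget] returns 0 when there is no Riesz representative. *)
Lemma adjointP T y : (forall x, <|T x, y|> = <|x, adjoint T y|>) \/ adjoint T y = 0.
Proof.
rewrite /adjoint; case: (pselect (exists z, forall x, <|T x, y|> = <|x, z|>)) => h.
  by left; exact: (xgetPex 0 h).
by right; apply: xgetPN => z hz; apply: h; exists z.
Qed.

Lemma adjointE T y z : (forall x, <|T x, y|> = <|x, z|>) -> adjoint T y = z.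
Proof.
move=> hz; have h : exists z, forall x, <|T x, y|> = <|x, z|> by exists z.
have hA : forall x, <|T x, y|> = <|x, adjoint T y|> by exact: (xgetPex 0 h).
apply/eqP; rewrite -subr_eq0; apply/eqP/dot_eq0_all => x.
by rewrite dot_conj dotBr -hA -hz subrr conjC0.
Qed.

Lemma homogeneous_solution n m (F : 'I_m -> 'I_n -> R[i]) : (n < m)%N ->
  exists2 c : 'I_m -> R[i], (exists i, c i != 0) & forall k, \sum_i c i * F i k = 0.
Proof.
move=> nm; pose A : 'M[R[i]]_(m, n) := \matrix_(i, k) F i k.
have : kermx A != 0.
  rewrite kermx_eq0; apply/negP; rewrite /row_free => /eqP rA.
  by have := rank_leq_col A; rewrite rA leqNgt nm.
move=> /rowV0Pn[c cA c0]; exists (fun i => c 0 i).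
  by apply/rV0Pn.
move=> k; have /sub_kermxP /matrixP /(_ 0 k) := cA.
rewrite !mxE => h; rewrite -[RHS]h; apply: eq_bigr => i _; by rewrite mxE.
Qed.

(** Among combinations of j + 1 > 2n eigenvectors, some nonzero x has both x and T x orthogonal to
    all [b k], whence the count n + n. Then |T x|^2 <= M |x| |T x|, while the eigenvalues give |T
    x|^2 >= l |x|^2. *)
Lemma singular_value_le T (W : set H) n (b : 'I_n -> H) (M : R) j :
  linear T -> 0 <= M -> (n + n <= j)%N ->
  (forall x, (forall k, <|x, b k|> = 0) -> W x) ->
  (forall x y, W x -> W y -> cnorm <|T x, y|> <= M * (hnorm x * hnorm y)) ->
  singular_value T j <= M.
Proof.
move=> lT M0 nj bW TM.
have M2 : 0 <= M ^+ 2 by exact: sqr_ge0.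
rewrite /singular_value -[leRHS](ger0_norm M0) -sqrtr_sqr ler_wsqrtr //.
rewrite /ordered_eigenvalue; apply: ge_sup; first by exists 0; left.
move=> l [->//|[v [ov vm]]].
have [l0|l0] := leP l 0; first exact: le_trans l0 M2.
have /choice[m mE] : forall i, exists m : R, l <= m /\
    (adjoint T \o T) (v i) = m%:C *: v i.
  by move=> i; have [m lm vE] := vm i; exists m.
have v_neq0 i : v i != 0 by rewrite -hnorm_eq0 (orthonormal_hnorm _ ov) oner_neq0.
(* [l > 0] makes [m i] nonzero, which rules out the default value 0 of [adjoint]. *)
have adj i x : <|T x, T (v i)|> = (m i)%:C * <|x, v i|>.
  have [lm /= vE] := mE i; have [h|h] := adjointP T (T (v i)).
    by rewrite h vE dotZr conjC_real.
  move: vE; rewrite h => /esym/eqP; rewrite scaler_eq0 (negbTE (v_neq0 i)) orbF.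
  rewrite -[0]/(0%:C) (inj_eq (@complexI R)) => /eqP m0.
  by rewrite m0 leNgt l0 in lm.
have nj1 : (n + n < j.+1)%N by [].
pose F (i : 'I_j.+1) (k : 'I_(n + n)) := match fintype.split k with
  | inl k => <|v i, b k|> | inr k => <|T (v i), b k|> end.
have [c [i0 ci0] cF] := homogeneous_solution F nj1.
pose x := \sum_i c i *: v i.
have Tx : T x = \sum_i c i *: T (v i).
  by rewrite (lin_sum _ _ _ lT); apply: eq_bigr => i _; rewrite (linZ lT).
have Wx : W x.
  apply: bW => k; have := cF (lshift n k); rewrite dot_suml => h; rewrite -[RHS]h.
  by apply: eq_bigr => i _; rewrite dotZl /F (unsplitK (inl k)).
have WTx : W (T x).
  apply: bW => k; have := cF (rshift n k); rewrite Tx dot_suml => h; rewrite -[RHS]h.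
  by apply: eq_bigr => i _; rewrite dotZl /F (unsplitK (inr k)).
have nx : hnorm x ^+ 2 = \sum_i cnorm (c i) ^+ 2 by exact: hnorm_comb.
have nTx : hnorm (T x) ^+ 2 = \sum_i m i * cnorm (c i) ^+ 2.
  apply: complexI; rewrite -dotE {2}Tx dot_sumr rmorph_sum; apply: eq_bigr => i _ /=.
  rewrite dotZr adj (dot_comb ov) rmorphM /= cnorm_sqr; ring.
have x0 : 0 < hnorm x.
  rewrite lt_neqAle hnorm_ge0 andbT eq_sym -sqrf_eq0 nx psumr_eq0; last first.
    by move=> i _; exact: sqr_ge0.
  by apply/allPn; exists i0; rewrite ?mem_index_enum // sqrf_eq0 cnorm_eq0.
have lTx : l * hnorm x ^+ 2 <= hnorm (T x) ^+ 2.
  rewrite nx nTx mulr_sumr; apply: ler_sum => i _.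
  by apply: ler_wpM2r; [exact: sqr_ge0|exact: (mE i).1].
have TxM : hnorm (T x) <= M * hnorm x.
  have := TM x (T x) Wx WTx; rewrite dotE cnormC ger0_norm ?sqr_ge0 // expr2 mulrA.
  have [->|nT] := eqVneq (hnorm (T x)) 0; first by rewrite mulr_ge0 ?(ltW x0).
  by rewrite ler_pM2r // lt_neqAle eq_sym nT hnorm_ge0.
have : l * hnorm x ^+ 2 <= M ^+ 2 * hnorm x ^+ 2.
  apply: le_trans lTx _; rewrite -exprMn; apply: lerXn2r; rewrite ?nnegrE ?hnorm_ge0 //.
  by rewrite mulr_ge0 ?(ltW x0).
by rewrite ler_pM2r // exprn_gt0.
Qed.

Lemma singular_value_ge T (M : R) j (v : 'I_j.+1 -> H) (s : 'I_j.+1 -> R) (l : R) :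
  (forall x, hnorm (T x) <= M * hnorm x) -> orthonormal_family v ->
  (forall i, T (v i) = (s i)%:C *: v i) ->
  (forall i x, <|T x, v i|> = (s i)%:C * <|x, v i|>) ->
  0 <= l -> (forall i, l <= `|s i|) -> l <= singular_value T j.
Proof.
move=> TM ov Tv symT l0 ls.
rewrite /singular_value -[leLHS](ger0_norm l0) -sqrtr_sqr ler_wsqrtr //.
apply: ub_le_sup.
  (* The set must be bounded above: its eigenvalue at a unit vector w is |T w|^2, or 0 if [adjoint]
     takes its default value. *)
  exists (M ^+ 2) => k [->|[w [ow wm]]]; first exact: sqr_ge0.
  have [m km /= wE] := wm ord0; apply: le_trans km _.
  have w1 := orthonormal_hnorm ord0 ow.
  have [h|h] := adjointP T (T (w ord0)); last first.
    move: wE; rewrite h => /esym/eqP; rewrite scaler_eq0 -[w _ == 0]hnorm_eq0 w1 oner_eq0 orbF.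
    by rewrite -[0]/(0%:C) (inj_eq (@complexI R)) => /eqP ->; exact: sqr_ge0.
  have := h (w ord0); rewrite wE dotZr conjC_real dotE (ow ord0 ord0) eqxx mulr1.
  move=> /complexI <-; have := TM (w ord0); rewrite w1 mulr1 => h'.
  by apply: lerXn2r; rewrite ?nnegrE ?hnorm_ge0 // (le_trans (hnorm_ge0 _) h').
right; exists v; split=> // i; exists (s i ^+ 2).
  rewrite -(real_normK (num_real (s i))).
  by apply: lerXn2r; rewrite ?nnegrE.
rewrite /= Tv; apply: adjointE => x.
by rewrite !dotZr !conjC_real symT expr2 rmorphM mulrA.
Qed.

Lemma compact_op_bounded T : compact_op T -> exists M, forall x, hnorm (T x) <= M * hnorm x.
Proof.
move=> [lT /precompact_tot_bounded /(_ 1 ltr01)[s sT]].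
pose M := \sum_(y <- s) hnorm y + 1.
have M_ball x : hnorm x <= 1 -> hnorm (T x) <= M.
  move=> x1; have [y ys yx] := sT (T x) (ex_intro2 _ _ x x1 erefl).
  rewrite -(subrK y (T x)) addrC; apply: le_trans (ler_hnormD _ _) _.
  apply: lerD (ltW yx); rewrite (big_rem y) //= lerDl sumr_ge0 // => z _.
  exact: hnorm_ge0.
exists M => x; have [->|x0] := eqVneq x 0.
  by rewrite (lin0 lT) hnorm0 mulr0.
have nx : 0 < hnorm x by rewrite lt_neqAle eq_sym hnorm_eq0 x0 hnorm_ge0.
have := M_ball ((hnorm x)^-1%:C *: x).
rewrite (linZ lT) !hnormZ !cnormC gtr0_norm ?invr_gt0 // mulVf ?gt_eqF // => /(_ (lexx _)).
by rewrite mulrC ler_pdivrMr.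
Qed.

Lemma weak_norm_singular_value (r : R) T : (weak_norm r T < +oo)%E ->
  exists K : R, forall j, j.+1%:R `^ r^-1 * singular_value T j <= K.
Proof.
move=> wT.
have ub j : ((j.+1%:R `^ r^-1 * singular_value T j)%:E <= weak_norm r T)%E.
  by apply: ereal_sup_ubound; exists j.
have fw : weak_norm r T \is a fin_num.
  by rewrite fin_real // wT andbT (lt_le_trans _ (ub 0%N)) ?ltNyr.
by exists (fine (weak_norm r T)) => j; rewrite -lee_fin fineK.
Qed.

(** The vectors [e i] are eigenvectors of the partial inverse with eigenvalues of modulus at least 1
    / L, so its n-th singular value, at index n - 1, is at least 1 / L; the weak bound then limits
    n. *)
Lemma eigenvalue_count (D : operator H) (p : R) : 0 < p -> selfadjoint D ->
  summable_op p D -> exists2 K : R, 0 < K &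
    forall (L : R) n (e : 'I_n -> H) (lam : 'I_n -> R), 0 < L -> orthonormal_family e ->
      (forall i, [/\ dom D (e i), D (e i) = (lam i)%:C *: e i, lam i != 0 & `|lam i| <= L]) ->
      n%:R <= (K * L) `^ p.
Proof.
move=> p0 [linD _ sD] [S hS [domS cS /weak_norm_singular_value[K0 hK0]]].
pose K := `|K0| + 1.
have K1 : 0 < K by rewrite ltr_wpDl.
have [M SM] := compact_op_bounded cS.
exists K => // L [|j] e lam L0 oe eD; first by rewrite powR_ge0.
have Sdom x : dom S x by rewrite domS.
have Dsym x y : dom D x -> dom D y -> <|D x, y|> = <|x, D y|>.
  by move=> Dx Dy; exact: ((sD y (D y)).1 (conj Dy erefl)).
have D0 : D 0 = 0.
  by have := (linD.2 (-1) 0 0 linD.1 linD.1).2; rewrite scaler0 addr0 scaleN1r addNr.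
have DZ (c : R[i]) x : dom D x -> dom D (c *: x) /\ D (c *: x) = c *: D x.
  by move=> Dx; have := linD.2 c x 0 Dx linD.1; rewrite D0 !addr0.
have ker_orth i k : ker_op D k -> <|k, e i|> = 0.
  move=> [Dk k0]; have [Dei eiE li _] := eD i.
  have := Dsym _ _ Dk Dei; rewrite k0 dot0l eiE dotZr conjC_real => /esym/eqP.
  rewrite mulf_eq0 => /orP[|/eqP//].
  by rewrite -[0]/(0%:C) (inj_eq (@complexI R)) (negbTE li).
(* Eigenvectors with nonzero eigenvalue are orthogonal to the kernel, so they meet the condition
   defining the partial inverse. *)
have Se i : S (e i) = (lam i)^-1%:C *: e i.
  have [Dei eiE li _] := eD i.
  apply: ((hS (e i) _).2 _).2; split.
  - exact: (DZ _ _ Dei).1.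
  - by move=> k kk; rewrite dotZl dot_conj ker_orth // conjC0 mulr0.
  - rewrite (DZ _ _ Dei).2 eiE scalerA -rmorphM mulVf // scale1r subrr.
    by split; [exact: linD.1|].
have symS i x : <|S x, e i|> = (lam i)^-1%:C * <|x, e i|>.
  have [Dei eiE li _] := eD i.
  have [DSx _ kx] := (hS x (S x)).1 (conj (Sdom x) erefl).
  have : <|x - D (S x), e i|> = 0 by exact: ker_orth.
  rewrite dotBl Dsym // eiE dotZr conjC_real => /eqP; rewrite subr_eq0 => /eqP ->.
  by rewrite mulrA -rmorphM mulVf // mul1r.
have : L^-1 <= singular_value S j.
  apply: (singular_value_ge SM oe Se symS); first by rewrite invr_ge0 ltW.
  move=> i; have [_ _ li lL] := eD i.
  by rewrite normfV lef_pV2 ?posrE ?normr_gt0.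
move=> /(ler_wpM2l (powR_ge0 j.+1%:R p^-1)) /le_trans /(_ (hK0 j)).
rewrite ler_pdivrMr // => h.
have {}h : j.+1%:R `^ p^-1 <= K * L.
  apply: le_trans h _; apply: ler_wpM2r; first exact: ltW.
  by apply: le_trans (ler_norm _) _; rewrite lerDl.
have := ge0_ler_powR (ltW p0) _ _ h.
rewrite -powRrM mulVf ?gt_eqF // powRr1 //; apply; rewrite nnegrE ?powR_ge0 //.
by rewrite mulr_ge0 ?ltW.
Qed.

End SingularValues.

(** * Compactness of the commutator *)

Section CommutatorCompact.
Variables (R : realType) (H : hilbertType R) (D P : operator H) (q : R).
Local Notation MT := (measurableTypeR R).
Variable E : set MT -> H -> H.
Hypotheses (hE : is_pvm E) (hD : is_spectral_integral E id D).
Hypotheses (sD : selfadjoint D) (rD : compact_resolvent D).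
Hypotheses (q0 : 0 < q) (hP : is_spectral_integral E (abs_neg_power q) P).
Variables (a : H -> H) (delta : R).
Hypotheses (ba : bounded_op a) (adom : forall x, dom D x -> dom D (a x)).
Hypotheses (delta0 : 0 <= delta)
  (hdelta : forall x, dom D x -> hnorm (D (a x) - a (D x)) <= delta * hnorm x).

Let T x := P (a x) - a (P x).

(** With I = {|l| < L} and B its complement, T = E(B) T E(B) + E(B) T E(I) + E(I) T. The last two
    terms map the unit ball to totally bounded sets, and the first is small for large L. *)
Lemma commutator_compact : compact_op T.
Proof.
have bT : bounded_op T := commutator_bounded hE hD sD rD q0 hP ba.
have [lT [K TK]] := bT.
split=> //; apply: tot_bounded_precompact => e e0.
pose c := (2 * q + 4) * delta.
have c0 : 0 <= c by rewrite mulr_ge0 // addr_ge0 // mulr_ge0 // ltW.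
(* For L >= 1 the form bound is at most c / L, which this choice makes at most e / 2. *)
pose L := 1 + 2 * c / e.
have L1 : 1 <= L by rewrite lerDl divr_ge0 ?(ltW e0) // mulr_ge0.
have L0 : 0 < L by exact: lt_le_trans L1.
pose I : set MT := [set l : R | `|l| < L].
have mI : measurable I by exact: measurable_norm_lt.
pose B := ~` I.
have mB : measurable B by exact: measurableC.
have BL : B `<=` gap_set L by move=> l /= /negP; rewrite -leNgt; right.
pose M := (2 * q + 4) * (L `^ (- q) / L) * delta.
have M0 : 0 <= M.
  rewrite mulr_ge0 // mulr_ge0 ?divr_ge0 ?powR_ge0 ?(ltW L0) //.
  by rewrite addr_ge0 // mulr_ge0 // ltW.
have Me : M <= e / 2.
  have -> : M = c * (L `^ (- q) / L) by rewrite /M /c; ring.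
  apply: le_trans (_ : c * (1 / L) <= _).
    apply: ler_wpM2l => //; apply: ler_wpM2r; first by rewrite invr_ge0 ltW.
    by rewrite -[leRHS](powRr0 L); apply: ler_powR => //; rewrite oppr_le0 ltW.
  rewrite mul1r ler_pdivrMr // /L.
  have -> : e / 2 * (1 + 2 * c / e) = e / 2 + c by field; rewrite gt_eqF.
  by rewrite lerDr divr_ge0 // ltW.
have bEB : bounded_op (E B) := pvm_bounded hE mB.
have tI : tot_bounded [set x | E I x = x /\ hnorm x <= 1].
  by apply: (pvm_range_tot_bounded hE hD sD rD (K := L) mI) => l /ltW.
have bscale : bounded_op (fun x : H => (`|K| + 1)%:C *: x).
  split; first by move=> k x y; rewrite scalerDr !scalerA mulrC.
  by exists (`|K| + 1) => x; rewrite hnormZ cnormC ger0_norm // addr_ge0.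
have tA := tot_boundedD (tot_bounded_image (bounded_op_comp bEB bT) tI)
  (tot_bounded_image bscale tI).
have [|s sA] := tA (e / 2); first by rewrite divr_gt0.
exists s => _ [x /= x1 <-].
pose u := E B (T (E I x)); pose v := E I (T x).
have K1 : 0 < `|K| + 1 by rewrite ltr_wpDl.
have [y ys uvy] : exists2 y, y \in s & hnorm (u + v - y) < e / 2.
  apply: sA; exists u.
    exists (E I x) => //; split; first exact: pvm_idem.
    exact: le_trans (hnorm_pvm hE _ mI) x1.
  exists v => //; exists ((`|K| + 1)^-1%:C *: v); last first.
    by rewrite scalerA -rmorphM mulfV ?gt_eqF // scale1r.
  split; first by rewrite (linZ (pvm_linear hE mI)) /v (pvm_idem hE).
  rewrite hnormZ cnormC gtr0_norm ?invr_gt0 // mulrC ler_pdivrMr // mul1r.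
  apply: le_trans (hnorm_pvm hE _ mI) _; apply: le_trans (TK x) _.
  apply: le_trans (_ : `|K| * 1 <= _); last by rewrite mulr1 lerDl.
  apply: le_trans (_ : `|K| * hnorm x <= _); last exact: ler_wpM2l.
  by apply: ler_wpM2r; [exact: hnorm_ge0|exact: ler_norm].
exists y => //.
have TE : T x = E B (T (E B x)) + (u + v).
  rewrite /u /v addrA -(linD (pvm_linear hE mB)) -(linD lT).
  by rewrite [E B x + _]addrC -(pvm_split hE x mI) addrC -(pvm_split hE (T x) mI).
rewrite TE -addrA; apply: le_lt_trans (ler_hnormD _ _) _.
rewrite [e]splitr; apply: ler_ltD => //.
apply: le_trans Me; apply: hnorm_le_dot => // z.
rewrite (pvm_selfadj hE) //.
apply: le_trans (commutator_form_gap hE hD sD rD q0 hP ba adom delta0 hdelta L0 mB BL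
  (pvm_idem hE _ mB) (pvm_idem hE _ mB)) _.
rewrite -/M; apply: ler_wpM2l => //; rewrite -[leRHS]mul1r.
apply: ler_pM; rewrite ?hnorm_ge0 //; last exact: (hnorm_pvm hE).
exact: le_trans (hnorm_pvm hE _ mB) x1.
Qed.

End CommutatorCompact.

(** Boundedness of the commutator makes the supremum in [opnorm] a genuine upper bound; homogeneity
    extends it beyond the unit ball. *)
Lemma opnorm_commutator (R : realType) (H : hilbertType R) (D : operator H) (a : H -> H) :
  linear_op D -> linear a -> (forall x, dom D x -> dom D (a x)) ->
  (exists M : R, forall x, dom D x -> hnorm (commutator D a x) <= M * hnorm x) ->
  0 <= opnorm (commutator D a) /\ forall x, dom D x ->
    hnorm (D (a x) - a (D x)) <= opnorm (commutator D a) * hnorm x.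
Proof.
move=> [D0 lD] la adom [M hM].
have Dz : D 0 = 0.
  by have := (lD (-1) 0 0 D0 D0).2; rewrite scaler0 addr0 scaleN1r addNr.
have DZ (c : R[i]) x : dom D x -> dom D (c *: x) /\ D (c *: x) = c *: D x.
  by move=> Dx; have := lD c x 0 Dx D0; rewrite Dz !addr0.
have ub x : dom D x -> hnorm x <= 1 -> hnorm (D (a x) - a (D x)) <= opnorm (commutator D a).
  move=> Dx x1; apply: ub_le_sup.
    exists `|M| => _ [z [[/= Dz' _] z1] <-]; apply: le_trans (hM z Dz') _.
    apply: le_trans (_ : `|M| * hnorm z <= _).
      by apply: ler_wpM2r; [exact: hnorm_ge0|exact: ler_norm].
    by rewrite ler_piMr.
  by exists x => //; split=> //; split=> //; exact: adom.
split=> [|x Dx].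
  by apply: le_trans (ub 0 D0 _); rewrite ?hnorm_ge0 // hnorm0.
have [->|x0] := eqVneq x 0.
  by rewrite Dz (lin0 la) Dz subrr hnorm0 mulr0.
have nx : 0 < hnorm x by rewrite lt_neqAle eq_sym hnorm_eq0 x0 hnorm_ge0.
pose k := (hnorm x)^-1%:C : R[i].
have [Dkx kxE] := DZ k x Dx.
have := ub (k *: x) Dkx.
rewrite kxE !(linZ la) (DZ k _ (adom _ Dx)).2 -scalerBr !hnormZ cnormC gtr0_norm ?invr_gt0 //.
by rewrite mulVf ?gt_eqF // => /(_ (lexx _)); rewrite mulrC ler_pdivrMr.
Qed.

Theorem lemma9 (R : realType) (H : hilbertType R) (D absDq : operator H)
    (p q : R) :
  0 < p -> 0 < q ->
  dirac_operator D -> summable_op p D ->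
  borel_calculus D (abs_neg_power q) absDq ->
  exists2 C : R, 0 < C &
    forall A : set (H -> H), spectral_triple A D ->
    forall a : H -> H, A a ->
      weak_schatten ((q + 1)^-1 * p) (commutator absDq a) /\
      (weak_norm ((q + 1)^-1 * p) (commutator absDq a)
         <= (C * opnorm (commutator D a))%:E)%E.
Proof.
move=> p0 q0 [sD rD] sumD [E [hE hD hP]].
have [K K0 countK] := eigenvalue_count p0 sD sumD.
have [eps eps0 Ee] := spectral_gap hE hD sD rD.
have m0 : measurable ([set 0] : set (measurableTypeR R)) by exact: measurable_set1.
have b0 : bounded_by (1 : R) [set 0] by move=> l /= ->; rewrite normr0.
(* [n0] is the dimension of the kernel, which [eigenvalue_count] does not see. *)
have [n0 [e0 [lam0 [[oe0 Ve0 e0B] _]]]] := pvm_eigenbasis hE hD sD rD m0 b0.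
pose s := (q + 1) / p.
have s0 : 0 < s by rewrite divr_gt0 // addr_gt0.
(* With L = ((j + 1) / c)^(1/p), at most (j + 1) / 8 nonzero eigenvalues have modulus at most L. *)
pose c := 8 * K `^ p.
have c0 : 0 < c by rewrite mulr_gt0 // powR_gt0.
(* From this index on the kernel also takes at most an eighth of j + 1, so twice the total rank is
   at most j. *)
pose J0 := (8 * n0.+1)%N.
pose C0 := 2 * q + 4.
have C00 : 0 < C0 by rewrite addr_gt0 // mulr_gt0.
pose epsq := eps `^ (- q) / eps.
have epsq0 : 0 <= epsq by rewrite divr_ge0 ?powR_ge0 // ltW.
exists (C0 * (c `^ s + J0%:R `^ s * epsq)).
  by rewrite mulr_gt0 // ltr_pwDl ?powR_gt0 // mulr_ge0 // powR_ge0.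
move=> A hA a Aa.
have ba := st_bounded hA Aa.
have adom x : dom D x -> dom D (a x) by move=> Dx; apply: (st_dom hA Aa); exists x.
have lD : linear_op D by case: sD.
have [d0 hd] := opnorm_commutator lD ba.1 adom (st_comm hA Aa).
set delta := opnorm _ in d0 hd *.
pose T x := absDq (a x) - a (absDq x).
have linT : linear T := (commutator_bounded hE hD sD rD q0 hP ba).1.
have rE : ((q + 1)^-1 * p)^-1 = s by rewrite invfM invrK.
have [C1 C2] : (forall j, (J0 <= j.+1)%N ->
      j.+1%:R `^ s * singular_value T j <= C0 * c `^ s * delta) /\
    (forall j, singular_value T j <= C0 * epsq * delta).
  split=> [j Jj|j]; last first.
    (* No vector has to be removed, as every vector lies in the range of the projection onto
       [gap_set eps]. *)
    apply: (@singular_value_le _ _ T setT 0 (fun=> 0) _ j linT) => //.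
      by rewrite mulr_ge0 // mulr_ge0 // ltW.
    move=> x y _ _; apply: (commutator_form_gap hE hD sD rD q0 hP ba adom d0 hd eps0
      (measurable_gap_set eps) (@subset_refl _ _)); exact: Ee.
  pose t : R := j.+1%:R / c.
  have t0 : 0 < t by rewrite divr_gt0.
  pose L := t `^ p^-1.
  have L0 : 0 < L by rewrite powR_gt0.
  have KLp : (K * L) `^ p = j.+1%:R / 8.
    rewrite powRM ?(ltW K0) ?(ltW L0) // /L -powRrM mulVf ?gt_eqF // powRr1 ?(ltW t0) //.
    by rewrite /t /c; field; rewrite gt_eqF // powR_gt0.
  (* L^(-q-1) = ((j + 1) / c)^(-s), so the weight (j + 1)^s of the weak norm cancels. *)
  have LE : L `^ (- q) / L = (j.+1%:R `^ s)^-1 * c `^ s.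
    have -> : L `^ (- q) / L = (t `^ s)^-1.
      rewrite -[X in _ / X = _]powRr1 ?(ltW L0) // -powRB ?(gt_eqF L0) ?implybT //.
      rewrite -opprD powRN /L -powRrM; congr (_ `^ _)^-1; rewrite /s; ring.
    have -> : j.+1%:R `^ s = t `^ s * c `^ s.
      by rewrite -powRM ?(ltW t0) ?(ltW c0) // /t divfK ?gt_eqF.
    by field; rewrite !gt_eqF // powR_gt0.
  pose I : set (measurableTypeR R) := [set l : R | `|l| < L].
  have mI : measurable I by exact: measurable_norm_lt.
  pose B := ~` I.
  have mB : measurable B by exact: measurableC.
  have BL : B `<=` gap_set L by move=> l /= /negP; rewrite -leNgt; right.
  have mI0 : measurable (I `\ 0) by exact: measurableD.
  have bI0 : bounded_by L (I `\ 0) by move=> l [/= /ltW].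
  have [n1 [e1 [lam1 [[oe1 Ve1 e1B] ee1]]]] := pvm_eigenbasis hE hD sD rD mI0 bI0.
  have n1j : n1%:R <= j.+1%:R / 8 :> R.
    rewrite -KLp; apply: (countK L n1 e1 lam1 L0 oe1) => i.
    have [de De _ [/= Ii ni]] := ee1 i.
    by split=> //; [apply/eqP|exact: ltW].
  have nj : (n0 + n1 + (n0 + n1) <= j)%N.
    have n1j' : (8 * n1 <= j.+1)%N.
      by rewrite -(ler_nat R) natrM mulrC -ler_pdivlMr.
    rewrite /J0 in Jj; lia.
  pose b (k : 'I_(n0 + n1)) := match fintype.split k with inl k => e0 k | inr k => e1 k end.
  have vanish (A' : set (measurableTypeR R)) m (e : 'I_m -> H) x : measurable A' ->
      orthonormal_basis [set x | E A' x = x] e -> (forall k, <|x, e k|> = 0) -> E A' x = 0.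
    move=> mA [_ Ve eA] xe; rewrite (eA (E A' x)); last exact: pvm_idem.
    rewrite big1 // => i _; rewrite (pvm_selfadj hE) //.
    by have := Ve i; rewrite /= => ->; rewrite xe scale0r.
  have bW x : (forall k, <|x, b k|> = 0) -> E B x = x.
    move=> xb.
    have v0 : E [set 0] x = 0.
      apply: (vanish _ _ e0 x m0) => // k.
      by have := xb (lshift n1 k); rewrite /b (unsplitK (inl k)).
    have v1 : E (I `\ 0) x = 0.
      apply: (vanish _ _ e1 x mI0) => // k.
      by have := xb (rshift n0 k); rewrite /b (unsplitK (inr k)).
    rewrite [RHS](pvm_split hE x mI) -/B (_ : E I x = 0) ?add0r //.
    rewrite (_ : I = [set 0] `|` (I `\ 0)).
      rewrite (pvmU hE) ?v0 ?v1 ?addr0 //.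
      by apply/seteqP; split=> l //= [-> []].
    apply/seteqP; split=> l /= => [Il|[->|[]//]].
      by case: (pselect (l = 0)) => h; [left|right].
    by rewrite /I /= normr0.
  have M0 : 0 <= C0 * (L `^ (- q) / L) * delta.
    by rewrite mulr_ge0 // mulr_ge0 ?divr_ge0 ?powR_ge0 ?(ltW L0) ?(ltW C00).
  have sle := @singular_value_le _ _ T [set x | E B x = x] _ b _ j linT M0 nj bW
    (fun x y Bx By => commutator_form_gap hE hD sD rD q0 hP ba adom d0 hd L0 mB BL Bx By).
  apply: le_trans (ler_wpM2l (powR_ge0 _ _) sle) _.
  rewrite LE le_eqVlt; apply/orP; left; apply/eqP; field.
  by rewrite gt_eqF // powR_gt0.
have key : (weak_norm ((q + 1)^-1 * p) (commutator absDq a) <=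
    (C0 * (c `^ s + J0%:R `^ s * epsq) * delta)%:E)%E.
  apply: ge_ereal_sup => _ [j _ <-]; rewrite lee_fin rE -/T.
  (* The first summand covers the indices with j + 1 >= J0, the second those below, where (j + 1)^s
     <= J0^s. *)
  have -> : C0 * (c `^ s + J0%:R `^ s * epsq) * delta =
    C0 * c `^ s * delta + J0%:R `^ s * (C0 * epsq * delta) by ring.
  have [/C1 h|jJ] := leqP J0 j.+1.
    apply: le_trans h _; rewrite lerDl mulr_ge0 ?powR_ge0 // mulr_ge0 // mulr_ge0 //.
    exact: ltW.
  apply: (@le_trans _ _ (J0%:R `^ s * (C0 * epsq * delta))); last first.
    by rewrite lerDr mulr_ge0 // mulr_ge0 ?powR_ge0 // ltW.
  apply: ler_pM; rewrite ?powR_ge0 ?sqrtr_ge0 //.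
  by apply: ge0_ler_powR; rewrite ?nnegrE ?ler0n ?(ltW s0) // ler_nat ltnW.
split=> //; split.
- apply/seteqP; split=> x // _; split; exact: (power_domP hE hD sD rD q0 hP).
- exact: (commutator_compact hE hD sD rD q0 hP ba adom d0 hd).
- exact: le_lt_trans key (ltry _).
Qed.
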